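(* Let $K:=\int_0^\infty \frac{ds}{f(s)}$. Then $$\lim_{\alpha\to\infty}\lambda^*(\alpha)\left(\frac{2K\alpha}{\log\alpha}\right)^{-1}=1 .$$
   Context: $B$ is the open unit disk in $\mathbb{R}^2$ centered at the origin, and $r=|x|$. Standing assumptions: $f:[0,\infty)\to(0,\infty)$ is a $C^1$ convex non-decreasing function with $\int_0^\infty \frac{ds}{f(s)}<\infty$; $\varphi,\psi$ are non-negative, non-increasing, Lipschitz continuous functions on $[0,1]$ with $\varphi(0)=\psi(0)=1$ and $\varphi>0$ on $[0,1)$; and $\int_0^1 M(s)\,ds<\infty$, where $M(s):=\max_{r\in[0,s]}\frac{\psi(r)}{\varphi(r)}$. For parameters $\lambda>0$, $\alpha>0$ consider the problem $$-\Delta u-\alpha r\varphi(r)\frac{\partial u}{\partial r}=\lambda\psi(r)f(u)\ \text{ in } B,\qquad u>0\ \text{ in } B,\qquad u=0\ \text{ on }\partial B. \quad (P_{\lambda,\alpha})$$ For each fixed $\alpha>0$, $\lambda^*(\alpha)\in(0,\infty)$ denotes the extremal value of $\lambda$: $(P_{\lambda,\alpha})$ has a classical solution (and a unique minimal, i.e. pointwise smallest, one) for every $\lambda\in(0,\lambda^*(\alpha))$, and has no solution for $\lambda>\lambda^*(\alpha)$. *)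

(* Defs.v *)
From Stdlib Require Export Reals Lra.
From Coquelicot Require Export Coquelicot.
Open Scope R_scope.

Definition nonneg_reals (s : R) : Prop := 0 <= s.

Definition unit_interval (s : R) : Prop := 0 <= s <= 1.

(* [D_in] and [continue_in] are relative to [D], so derivatives and continuity
   are one-sided at end points of [D] that belong to [D]. *)
Definition C1_on (D : R -> Prop) (f : R -> R) : Prop :=
  exists df : R -> R, forall x, D x -> D_in f df D x /\ continue_in df D x.

Definition convex_on (D : R -> Prop) (f : R -> R) : Prop :=
  forall x y t, D x -> D y -> 0 <= t <= 1 ->
    f (t * x + (1 - t) * y) <= t * f x + (1 - t) * f y.

Definition nondecreasing_on (D : R -> Prop) (f : R -> R) : Prop :=
  forall x y, D x -> D y -> x <= y -> f x <= f y.

Definition nonincreasing_on (D : R -> Prop) (f : R -> R) : Prop :=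
  forall x y, D x -> D y -> x <= y -> f y <= f x.

Definition lipschitz_on (D : R -> Prop) (f : R -> R) : Prop :=
  exists L : R, forall x y, D x -> D y -> Rabs (f x - f y) <= L * Rabs (x - y).

Definition is_max_on (D : R -> Prop) (g : R -> R) (m : R) : Prop :=
  (exists r, D r /\ g r = m) /\ (forall r, D r -> g r <= m).

Definition rad (x y : R) : R := sqrt (x ^ 2 + y ^ 2).

Definition disk (x y : R) : Prop := rad x y < 1.

Definition closed_disk (x y : R) : Prop := rad x y <= 1.

Definition circle (x y : R) : Prop := rad x y = 1.

Definition laplacian (u : R -> R -> R) (x y : R) : R :=
  partial_derive 2 0 u x y + partial_derive 0 2 u x y.

(* The gradient paired with the unit vector (x, y) / r.  At the origin this is
   a dummy value; [classical_solution] only uses it multiplied by r, and the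
   product r * du/dr is then 0 there, as it should be. *)
Definition radial_derivative (u : R -> R -> R) (x y : R) : R :=
  x / rad x y * partial_derive 1 0 u x y + y / rad x y * partial_derive 0 1 u x y.

(* u is of class C^2 in the open disk and continuous on the closed disk. *)
Definition classical_solution (f phi psi : R -> R) (lambda alpha : R)
    (u : R -> R -> R) : Prop :=
  (forall x y, disk x y -> ex_diff_n u 2 x y) /\
  continuous_on (fun p : R * R => closed_disk (fst p) (snd p))
    (fun p : R * R => u (fst p) (snd p)) /\
  (forall x y, disk x y ->
    - laplacian u x y
      - alpha * rad x y * phi (rad x y) * radial_derivative u x y
    = lambda * psi (rad x y) * f (u x y)) /\
  (forall x y, disk x y -> 0 < u x y) /\
  (forall x y, circle x y -> u x y = 0).

Definition solvable (f phi psi : R -> R) (alpha lambda : R) : Prop :=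
  0 < lambda /\ exists u, classical_solution f phi psi lambda alpha u.

Definition lambda_star (f phi psi : R -> R) (alpha : R) : Rbar :=
  Lub_Rbar (solvable f phi psi alpha).

Lemma lambda_star_unique (f phi psi : R -> R) (alpha l : R) :
  0 < l ->
  (forall lambda, 0 < lambda < l -> solvable f phi psi alpha lambda) ->
  (forall lambda, l < lambda -> ~ solvable f phi psi alpha lambda) ->
  lambda_star f phi psi alpha = Finite l.
Proof.
intros Hl Hex Hno; apply is_lub_Rbar_unique; split.
- intros x Hx; simpl.
  destruct (Rle_or_lt x l) as [H|H]; [exact H|].
  now destruct (Hno x H).
- intros [b| |] Hb; simpl; try exact I.
  + destruct (Rle_or_lt l b) as [H|H]; [exact H|].
    pose proof (Rmax_l b 0); pose proof (Rmax_r b 0).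
    assert (Rmax b 0 < l) by (apply Rmax_lub_lt; lra).
    assert (Hs : solvable f phi psi alpha ((Rmax b 0 + l) / 2))
      by (apply Hex; lra).
    specialize (Hb _ Hs); simpl in Hb; lra.
  + apply (Hb (l / 2)); apply Hex; lra.
Qed.

(* Main.v *)
(** Upper bound: let [F(s)] be the integral of [1/f] over [0, s].  If [u] is a solution,
    then [v = F(u)] is a supersolution of the linear problem with right-hand side
    [lambda psi], because [f' >= 0].  The logarithmic barrier
    [(lambda A / 2 alpha) (ln (d^2 + 2/alpha) - ln (r^2 + 2/alpha))] is a strict subsolution on
    the disk [r < d] as soon as [A < psi] there, so the maximum principle gives at the origin
    [lambda A ln (1 + alpha d^2 / 2) / (2 alpha) <= F(u(0)) < K].

    Lower bound: in the variable [t = r^2] the radial problem is an integral equation whose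
    monotone iteration converges below any supersolution.  A supersolution is
    [F^-1 (v0 - (mu/2) R)] with [v0 < K], [mu = lambda / alpha] and
    [R(t) = (1 + th)^3 ln ((t + c) / c) + D (integral of M over [0, sqrt t])], [c = th / alpha].
    The logarithm carries the main term [log alpha]; the integral of [M], multiplied by
    [mu ~ 2 K / log alpha], is negligible but absorbs the possible degeneracy of [phi]
    at [r = 1]. *)

(* Two obstacles shape the lower bound. First, [phi] may vanish at [r = 1] faster than [psi]. The
   inequality [psi <= M phi], with [M] frozen at the end of the interval of integration, turns the
   source into a multiple of the drift coefficient at the price of a factor [M], which is affordable
   because [M] is integrable. Second, [f] along the supersolution decreases with [r], which costs a
   term with [f']. Since [v0] stays away from [K], [f'] is bounded there independently of [alpha],
   and the term carries the factor [mu], which is small. Near the center a surplus of order [th]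
   pays for it; further out, a slowly growing factor does. The core of the logarithm has size
   [1 / alpha] because there diffusion and drift balance. The constant in front changes [ln alpha]
   only by a bounded amount: the upper bound takes 2, which makes the barrier exact enough, and the
   lower bound takes the smaller [th], which produces the surplus. The three factors [1 + th] in [R]
   pay for [M] near the center, for the cutoff of the flux bound and for the growing factor. *)
Require Import Defs.
From Stdlib Require Import Reals Lra Psatz List.
From Stdlib Require Import Classical ClassicalEpsilon FunctionalExtensionality.
From Coquelicot Require Import Coquelicot.
Open Scope R_scope.

(** * Calculus on the line and on a square *)

Lemma nondecreasing_of_derive (g dg : R -> R) (a b : R) :
  a <= b ->
  (forall x, a < x < b -> is_derive g x (dg x)) ->
  (forall x, a <= x <= b -> continuous g x) ->
  (forall x, a < x < b -> 0 <= dg x) ->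
  g a <= g b.
Proof.
intros Hab Hd Hc Hpos.
(* [MVT_gen] may return an end point, where nothing is known about [dg]; there the sign comes from
   the value 0. *)
set (dg0 := fun x => if Rlt_dec a x then if Rlt_dec x b then dg x else 0 else 0).
destruct (MVT_gen g a b dg0) as [c [_ Hc']].
- rewrite Rmin_left, Rmax_right by lra.
  intros x Hx; unfold dg0.
  destruct (Rlt_dec a x); [|lra]; destruct (Rlt_dec x b); [|lra].
  now apply Hd.
- rewrite Rmin_left, Rmax_right by lra.
  intros x Hx; apply continuity_pt_filterlim, Hc; lra.
- assert (0 <= dg0 c).
  { unfold dg0; destruct (Rlt_dec a c); [|lra]; destruct (Rlt_dec c b); [|lra].
    apply Hpos; lra. }
  nra.
Qed.

Lemma second_derivative_test (g dg : R -> R) (x0 l : R) :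
  locally x0 (fun x => is_derive g x (dg x)) ->
  is_derive dg x0 l ->
  locally x0 (fun x => g x0 <= g x) ->
  dg x0 = 0 /\ 0 <= l.
Proof.
intros [d1 Hd1] Hl [d2 Hd2].
assert (Hball : forall (d : posreal) x, Rabs (x - x0) < d -> ball x0 d x)
  by (intros d x Hx; exact Hx).
assert (H0 : dg x0 = 0).
{ assert (Hx0 : is_derive g x0 (dg x0)).
  { apply Hd1, Hball; rewrite Rminus_diag, Rabs_R0; apply cond_pos. }
  apply is_derive_Reals in Hx0.
  set (pr := exist _ (dg x0) Hx0 : derivable_pt g x0).
  change (dg x0) with (derive_pt g x0 pr).
  pose proof (cond_pos d2).
  apply (deriv_minimum g (x0 - d2) (x0 + d2)); try lra.
  intros x Hx1 Hx2; apply Hd2, Hball, Rabs_def1; lra. }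
split; [exact H0|].
destruct (Rle_or_lt 0 l) as [|Hneg]; [assumption|exfalso].
apply is_derive_Reals in Hl.
destruct (Hl (- l / 2)) as [d3 Hd3]; [lra|].
pose proof (cond_pos d1); pose proof (cond_pos d2); pose proof (cond_pos d3).
set (b := x0 + Rmin d1 (Rmin d2 d3) / 2).
assert (Hb : x0 < b /\ b - x0 < d1 /\ b - x0 < d2 /\ b - x0 < d3).
{ unfold b; unfold Rmin; repeat destruct Rle_dec; lra. }
assert (Hder : forall x, x0 <= x <= b -> is_derive g x (dg x)).
{ intros x Hx; apply Hd1, Hball; apply Rabs_def1; lra. }
(* If [l < 0], then [dg x <= l / 2 * (x - x0)] just to the right of [x0], so [g] drops below [g x0]
   at least as fast as a parabola. *)
assert (Hdecr : - g x0 + l / 4 * (x0 - x0) ^ 2 <= - g b + l / 4 * (b - x0) ^ 2).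
{ apply (nondecreasing_of_derive (fun x => - g x + l / 4 * (x - x0) ^ 2)
           (fun x => - dg x + l / 2 * (x - x0))).
  - lra.
  - intros x Hx.
    apply (is_derive_plus (fun x => - g x) (fun x => l / 4 * (x - x0) ^ 2)).
    + apply (is_derive_opp g), Hder; lra.
    + auto_derive; [trivial|field].
  - intros x Hx.
    apply (continuous_plus (fun x => - g x) (fun x => l / 4 * (x - x0) ^ 2)).
    + apply (continuous_opp g), ex_derive_continuous; exists (dg x); now apply Hder.
    + apply (ex_derive_continuous (fun x => l / 4 * (x - x0) ^ 2)); auto_derive; trivial.
  - intros x Hx.
    assert (Hq := Hd3 (x - x0)).
    replace (x0 + (x - x0)) with x in Hq by ring.
    assert (Hq' : Rabs ((dg x - dg x0) / (x - x0) - l) < - l / 2).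
    { apply Hq; [lra|]; apply Rabs_def1; lra. }
    apply Rabs_def2 in Hq'; rewrite H0 in Hq'.
    assert (dg x = (dg x - 0) / (x - x0) * (x - x0)) by (field; lra).
    nra. }
assert (g x0 <= g b) by (apply Hd2, Hball, Rabs_def1; lra).
assert (0 < (b - x0) ^ 2) by (apply pow_lt; lra).
nra.
Qed.

Lemma list_argmin {T : Type} (P : T -> Prop) (v : T -> R) (l : list T) :
  (exists t, In t l /\ P t) ->
  exists t, P t /\ forall s, In s l -> P s -> v t <= v s.
Proof.
induction l as [|a l IH]; intros [t [Hin Ht]]; [destruct Hin|].
destruct (classic (exists t, In t l /\ P t)) as [Hex|Hno].
- destruct (IH Hex) as [s [Hs Hmin]].
  destruct (classic (P a /\ v a < v s)) as [[Ha Hlt]|Hn].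
  + exists a; split; [exact Ha|]; intros s' [<-|Hs'] HP; [lra|].
    specialize (Hmin _ Hs' HP); lra.
  + exists s; split; [exact Hs|]; intros s' [<-|Hs'] HP; [|now apply Hmin].
    destruct (Rle_or_lt (v s) (v a)); [assumption|tauto].
- destruct Hin as [->|Hin]; [|now destruct Hno; exists t].
  exists t; split; [exact Ht|]; intros s [<-|Hs] HP; [lra|].
  destruct Hno; now exists s.
Qed.

(** If no minimum is attained, each point [p] has a neighbourhood on which one fixed point of the
    square beats every value. Finitely many of these neighbourhoods cover the square; the best of
    the associated points lies in one of them and is beaten strictly, a contradiction. *)
Lemma attains_min_on_square (h : R -> R -> R) (d : R) :
  0 <= d ->
  (forall x y, -d <= x <= d -> -d <= y <= d -> continuity_2d_pt h x y) ->
  exists x0 y0, (-d <= x0 <= d /\ -d <= y0 <= d) /\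
    forall x y, -d <= x <= d -> -d <= y <= d -> h x0 y0 <= h x y.
Proof.
intros Hd Hcont.
apply NNPP; intros Hno.
set (sq := bounded_n 2 (-d, (-d, tt)) (d, (d, tt))).
set (val := fun p : Compactness.Tn 2 R => h (fst p) (fst (snd p))).
assert (Hbetter : forall p : Compactness.Tn 2 R,
  exists bd : Compactness.Tn 2 R * posreal, sq p ->
    sq (fst bd) /\ forall z, close_n 2 (snd bd) z p -> val (fst bd) < val z).
{ intros p; destruct (classic (sq p)) as [Hp|Hp].
  - destruct p as [x [y []]]; destruct Hp as [Hx [Hy _]].
    destruct (classic (exists x' y', (-d <= x' <= d /\ -d <= y' <= d) /\ h x' y' < h x y))
      as [[x' [y' [[Hx' Hy'] Hlt]]]|Hn].
    + assert (Heps : 0 < h x y - h x' y') by lra.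
      destruct (Hcont x y Hx Hy (mkposreal _ Heps)) as [del Hdel].
      exists ((x', (y', tt)), del); intros _; split; [repeat split; lra|].
      intros [u [v []]] [Hu [Hv _]].
      specialize (Hdel u v Hu Hv); simpl in Hdel; apply Rabs_def2 in Hdel.
      unfold val; simpl; lra.
    + destruct Hno; exists x, y; split; [now split|].
      intros x' y' Hx' Hy'; destruct (Rle_or_lt (h x y) (h x' y')) as [|Hlt]; [assumption|].
      destruct Hn; now exists x', y'.
  - exists (p, mkposreal 1 Rlt_0_1); intros H; now destruct Hp. }
set (best := fun p => proj1_sig (constructive_indefinite_description _ (Hbetter p))).
assert (Hbest : forall p, sq p -> sq (fst (best p)) /\
  forall z, close_n 2 (snd (best p)) z p -> val (fst (best p)) < val z).
{ intros p; unfold best; now destruct constructive_indefinite_description. }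
(* The finite cover is available under a double negation only, which is enough as the goal is
   [False]. *)
apply (compactness_list 2 (-d, (-d, tt)) (d, (d, tt)) (fun p => snd (best p))).
intros [l Hl].
assert (Hsq0 : sq (0, (0, tt))) by (repeat split; lra).
destruct (list_argmin sq (fun p => val (fst (best p))) l) as [t [Ht Hmin]].
{ destruct (Hl _ Hsq0) as [t [Hin [Ht _]]]; now exists t. }
destruct (Hbest t Ht) as [Hbt _].
destruct (Hl _ Hbt) as [s [Hin [Hs Hclose]]].
destruct (Hbest s Hs) as [_ Hlt].
specialize (Hmin s Hin Hs); specialize (Hlt _ Hclose); lra.
Qed.

(** * The radial linear problem *)

Lemma continuous_plus_R (g h : R -> R) x :
  continuous g x -> continuous h x -> continuous (fun t => g t + h t) x.
Proof. apply (continuous_plus (V := R_NormedModule)). Qed.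

Lemma continuous_mult_R (g h : R -> R) x :
  continuous g x -> continuous h x -> continuous (fun t => g t * h t) x.
Proof. apply (continuous_mult (K := R_AbsRing)). Qed.

Lemma continuous_inv_R (g : R -> R) x :
  continuous g x -> g x <> 0 -> continuous (fun t => / g t) x.
Proof.
intros Hg H0; apply continuity_pt_filterlim, (continuity_pt_inv g); [|exact H0].
now apply continuity_pt_filterlim.
Qed.

Lemma is_derive_RInt_upper (g : R -> R) (a x : R) :
  (forall t, continuous g t) -> is_derive (RInt g a) x (g x).
Proof.
intros Hg; apply (is_derive_RInt g _ a); [|apply Hg].
apply filter_forall; intros y; apply (RInt_correct g), ex_RInt_continuous.
intros z _; apply Hg.
Qed.

Section Radial_operator.

Variables (a : R -> R) (k l : R).
Hypothesis a_cont : forall t, continuous a t.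
Hypothesis l_pos : 0 < l.

(** Integrating factor of the radial equation: with [q = - g'] the equation reads [(weight t * t * q
    t)' = l * weight t * w t]. *)
Definition weight (t : R) : R := exp (k * RInt a 0 t).

Definition flux (w : R -> R) (t : R) : R := RInt (fun s => weight s * w s) 0 t.

(** This is [- g'] for the solution [g]. The value at 0 is the limit of the quotient, so that
    [slope] is continuous across the singular point. *)
Definition slope (w : R -> R) (t : R) : R :=
  if Req_EM_T t 0 then l * w 0 else l * flux w t / (weight t * t).

(* In the variable [t = r^2] the solution operator of the linear radial problem
   [-4 (t g')' - 4 k a t g' = 4 l w], [g(1) = 0]. *)
Definition linear_solution (w : R -> R) (t : R) : R := RInt (slope w) t 1.

Lemma weight_pos t : 0 < weight t.
Proof. apply exp_pos. Qed.

Lemma weight_0 : weight 0 = 1.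
Proof.
unfold weight; rewrite RInt_point; unfold zero; simpl; rewrite Rmult_0_r; apply exp_0.
Qed.

Lemma is_derive_weight t : is_derive weight t (k * a t * weight t).
Proof.
apply (is_derive_comp exp (fun t => k * RInt a 0 t)).
- apply is_derive_exp.
- apply (is_derive_scal (RInt a 0)), is_derive_RInt_upper, a_cont.
Qed.

Lemma continuous_weight t : continuous weight t.
Proof. apply (ex_derive_continuous weight); eexists; apply is_derive_weight. Qed.

Lemma continuous_weighted w t :
  (forall t, continuous w t) -> continuous (fun s => weight s * w s) t.
Proof. intros Hw; apply continuous_mult_R; [apply continuous_weight|apply Hw]. Qed.

Lemma ex_RInt_weighted w x y :
  (forall t, continuous w t) -> ex_RInt (fun s => weight s * w s) x y.
Proof.
intros Hw; apply (ex_RInt_continuous (fun s => weight s * w s)).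
intros z _; now apply continuous_weighted.
Qed.

Lemma flux_0 w : flux w 0 = 0.
Proof. unfold flux; now rewrite RInt_point. Qed.

Lemma is_derive_flux w t :
  (forall t, continuous w t) -> is_derive (flux w) t (weight t * w t).
Proof.
intros Hw; apply (is_derive_RInt_upper (fun s => weight s * w s)).
intros s; now apply continuous_weighted.
Qed.

Lemma continuous_flux w t : (forall t, continuous w t) -> continuous (flux w) t.
Proof.
intros Hw; apply (ex_derive_continuous (flux w)); eexists; now apply is_derive_flux.
Qed.

Lemma slope_neq0 w t : t <> 0 -> slope w t = l * flux w t / (weight t * t).
Proof. intros Ht; unfold slope; destruct Req_EM_T; [contradiction|reflexivity]. Qed.

Lemma slope_at_0 w : slope w 0 = l * w 0.
Proof. unfold slope; destruct Req_EM_T; [reflexivity|now contradiction n]. Qed.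

Lemma locally_neq0 t : t <> 0 -> locally t (fun s => s <> 0).
Proof. intros Ht; apply (open_neq 0 t Ht). Qed.

Lemma is_derive_slope w t :
  (forall t, continuous w t) -> t <> 0 ->
  is_derive (slope w) t ((l * w t - k * a t * t * slope w t - slope w t) / t).
Proof.
intros Hw Ht; rewrite slope_neq0 by assumption.
apply (is_derive_ext_loc (fun t => l * flux w t / (weight t * t))).
{ generalize (locally_neq0 t Ht); apply filter_imp; intros s Hs; now rewrite slope_neq0. }
pose proof (weight_pos t).
assert (Hn : is_derive (fun t => l * flux w t) t (l * (weight t * w t))).
{ apply (is_derive_scal (flux w)); now apply is_derive_flux. }
assert (Hd : is_derive (fun t => weight t * t) t (k * a t * weight t * t + weight t * 1)).
{ apply (is_derive_mult weight (fun t => t)); [apply is_derive_weight| |].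
  - apply (is_derive_id (K := R_AbsRing)).
  - intros; apply Rmult_comm. }
replace ((l * w t - k * a t * t * (l * flux w t / (weight t * t)) - l * flux w t / (weight t * t)) / t)
  with ((l * (weight t * w t) * (weight t * t)
         - l * flux w t * (k * a t * weight t * t + weight t * 1)) / (weight t * t) ^ 2)
  by (field; lra).
apply (is_derive_div (fun t => l * flux w t) (fun t => weight t * t)); try assumption.
apply Rmult_integral_contrapositive; lra.
Qed.

Lemma continuous_slope w t : (forall t, continuous w t) -> continuous (slope w) t.
Proof.
intros Hw; destruct (Req_dec t 0) as [->|Ht].
2: { apply (ex_derive_continuous (slope w)); eexists; now apply is_derive_slope. }
(* As [flux] vanishes at 0, [slope w x] is the difference quotient at 0 of [l * flux / weight], so
   its limit is a derivative. *)
assert (Hd : is_derive (fun t => l * flux w t / weight t) 0 (l * w 0)).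
{ replace (l * w 0) with ((l * (weight 0 * w 0) * weight 0
         - l * flux w 0 * (k * a 0 * weight 0)) / (weight 0) ^ 2)
    by (rewrite weight_0, flux_0; field).
  apply (is_derive_div (fun t => l * flux w t) weight).
  - apply (is_derive_scal (flux w)); now apply is_derive_flux.
  - apply is_derive_weight.
  - rewrite weight_0; lra. }
apply is_derive_Reals in Hd.
apply continuity_pt_filterlim; intros eps Heps.
destruct (Hd eps Heps) as [d Hlim].
exists d; split; [apply cond_pos|].
intros x [[_ Hx0] Hx]; simpl in *; unfold Rdist in *.
rewrite Rminus_0_r in Hx.
specialize (Hlim x (not_eq_sym Hx0) Hx).
rewrite flux_0, Rplus_0_l in Hlim.
rewrite slope_at_0, slope_neq0 by now apply not_eq_sym.
pose proof (weight_pos x).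
replace (l * flux w x / (weight x * x))
  with ((l * flux w x / weight x - l * 0 / weight 0) / x); [exact Hlim|].
assert (x <> 0) by now apply not_eq_sym.
rewrite weight_0; field; lra.
Qed.

Lemma flux_le w1 w2 t :
  (forall t, continuous w1 t) -> (forall t, continuous w2 t) ->
  0 <= t -> (forall s, 0 < s < t -> w1 s <= w2 s) -> flux w1 t <= flux w2 t.
Proof.
intros H1 H2 Ht Hle; apply RInt_le; [exact Ht|now apply ex_RInt_weighted..|].
intros s Hs; apply Rmult_le_compat_l; [apply Rlt_le, weight_pos|now apply Hle].
Qed.

Lemma slope_le w1 w2 t :
  (forall t, continuous w1 t) -> (forall t, continuous w2 t) ->
  0 < t -> (forall s, 0 < s < t -> w1 s <= w2 s) -> slope w1 t <= slope w2 t.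
Proof.
intros H1 H2 Ht Hle; rewrite !slope_neq0 by lra.
pose proof (weight_pos t).
apply Rmult_le_compat_r; [apply Rlt_le, Rinv_0_lt_compat; nra|].
apply Rmult_le_compat_l; [lra|]; apply flux_le; try assumption; lra.
Qed.

Lemma ex_RInt_slope w x y : (forall t, continuous w t) -> ex_RInt (slope w) x y.
Proof.
intros Hw; apply (ex_RInt_continuous (slope w)); intros z _; now apply continuous_slope.
Qed.

Lemma linear_solution_1 w : linear_solution w 1 = 0.
Proof. unfold linear_solution; now rewrite RInt_point. Qed.

Lemma is_derive_linear_solution w t :
  (forall t, continuous w t) -> is_derive (linear_solution w) t (- slope w t).
Proof.
intros Hw.
apply (is_derive_ext (fun t => - RInt (slope w) 1 t)).
{ intros s; apply (opp_RInt_swap (slope w)); now apply ex_RInt_slope. }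
apply (is_derive_opp (RInt (slope w) 1)), is_derive_RInt_upper.
intros s; now apply continuous_slope.
Qed.

Lemma continuous_linear_solution w t :
  (forall t, continuous w t) -> continuous (linear_solution w) t.
Proof.
intros Hw; apply (ex_derive_continuous (linear_solution w)).
eexists; now apply is_derive_linear_solution.
Qed.

Lemma linear_solution_le w1 w2 t :
  (forall t, continuous w1 t) -> (forall t, continuous w2 t) ->
  0 <= t <= 1 -> (forall s, 0 < s < 1 -> w1 s <= w2 s) ->
  linear_solution w1 t <= linear_solution w2 t.
Proof.
intros H1 H2 Ht Hle; apply RInt_le; [lra|now apply ex_RInt_slope..|].
intros s Hs; apply slope_le; try assumption; [lra|].
intros s' Hs'; apply Hle; lra.
Qed.

Lemma linear_solution_lincomb w1 w2 e t :
  (forall t, continuous w1 t) -> (forall t, continuous w2 t) ->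
  linear_solution (fun s => w1 s + e * w2 s) t
  = linear_solution w1 t + e * linear_solution w2 t.
Proof.
intros H1 H2.
assert (Hflux : forall s, flux (fun s => w1 s + e * w2 s) s = flux w1 s + e * flux w2 s).
{ intros s; unfold flux.
  rewrite (RInt_ext _ (fun x => plus (weight x * w1 x) (scal e (weight x * w2 x)))).
  2: { intros x _; unfold plus, scal; simpl; unfold mult; simpl; ring. }
  rewrite (RInt_plus (fun x => weight x * w1 x) (fun x => scal e (weight x * w2 x))).
  - rewrite (RInt_scal (fun x => weight x * w2 x)); [reflexivity|now apply ex_RInt_weighted].
  - now apply ex_RInt_weighted.
  - apply (ex_RInt_scal (fun x => weight x * w2 x)); now apply ex_RInt_weighted. }
unfold linear_solution.
rewrite (RInt_ext _ (fun x => plus (slope w1 x) (scal e (slope w2 x)))).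
2: { intros x _; unfold slope, plus, scal; simpl; unfold mult; simpl.
     destruct Req_EM_T; [ring|]; rewrite Hflux; unfold Rdiv; ring. }
rewrite (RInt_plus (slope w1) (fun x => scal e (slope w2 x))).
- rewrite (RInt_scal (slope w2)); [reflexivity|now apply ex_RInt_slope].
- now apply ex_RInt_slope.
- apply (ex_RInt_scal (slope w2)); now apply ex_RInt_slope.
Qed.

Lemma slope_nonneg w t :
  (forall t, continuous w t) -> (forall s, 0 <= s <= 1 -> 0 <= w s) ->
  0 <= t <= 1 -> 0 <= slope w t.
Proof.
intros Hw Hpos Ht; destruct (Req_dec t 0) as [->|Ht0].
- rewrite slope_at_0; apply Rmult_le_pos; [lra|apply Hpos; lra].
- rewrite slope_neq0 by assumption.
  pose proof (weight_pos t).
  apply Rdiv_le_0_compat; [|nra].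
  apply Rmult_le_pos; [lra|].
  apply RInt_ge_0; [lra|now apply ex_RInt_weighted|].
  intros s Hs; apply Rmult_le_pos; [apply Rlt_le, weight_pos|apply Hpos; lra].
Qed.

(** The source may vanish away from the center, as [psi] may. The flux becomes positive on a short
    interval at 0, where [w] is near [w 0], and does not decrease afterwards. *)
Lemma slope_pos w t :
  (forall t, continuous w t) -> (forall s, 0 <= s <= 1 -> 0 <= w s) -> 0 < w 0 ->
  0 <= t <= 1 -> 0 < slope w t.
Proof.
intros Hw Hpos H0 Ht; destruct (Req_dec t 0) as [->|Ht0].
- rewrite slope_at_0; now apply Rmult_lt_0_compat.
- rewrite slope_neq0 by assumption.
  pose proof (weight_pos t).
  apply Rdiv_lt_0_compat; [|nra].
  apply Rmult_lt_0_compat; [lra|].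
  pose proof (Hw 0) as Hc; apply continuity_pt_filterlim in Hc.
  destruct (Hc (w 0) H0) as [d [Hd Hlim]]; simpl in Hlim; unfold Rdist in Hlim.
  set (s := Rmin t (d / 2)).
  assert (Hs : 0 < s <= t /\ s < d) by (unfold s, Rmin; destruct Rle_dec; lra).
  apply Rlt_le_trans with (flux w s).
  + destruct (MVT_gen (flux w) 0 s (fun t => weight t * w t)) as [c [Hc' HM]].
    * intros x _; now apply is_derive_flux.
    * intros x _; now apply continuity_pt_filterlim, continuous_flux.
    * rewrite Rmin_left, Rmax_right in Hc' by lra.
      rewrite flux_0 in HM.
      assert (0 < w c).
      { destruct (Req_dec 0 c) as [<-|Hne]; [exact H0|].
        assert (Hwc : Rabs (w c - w 0) < w 0).
        { apply Hlim; split; [now split|]; apply Rabs_def1; lra. }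
        apply Rabs_def2 in Hwc; lra. }
      assert (0 < weight c * w c) by (apply Rmult_lt_0_compat; [apply weight_pos|lra]).
      nra.
  + apply (nondecreasing_of_derive (flux w) (fun t => weight t * w t)); [lra|..].
    * intros x _; now apply is_derive_flux.
    * intros x _; now apply continuous_flux.
    * intros x Hx; apply Rmult_le_pos; [apply Rlt_le, weight_pos|apply Hpos; lra].
Qed.

Lemma linear_solution_nonneg w t :
  (forall t, continuous w t) -> (forall s, 0 <= s <= 1 -> 0 <= w s) ->
  0 <= t <= 1 -> 0 <= linear_solution w t.
Proof.
intros Hw Hpos Ht; apply RInt_ge_0; [lra|now apply ex_RInt_slope|].
intros s Hs; apply slope_nonneg; try assumption; lra.
Qed.

Lemma linear_solution_pos w t :
  (forall t, continuous w t) -> (forall s, 0 <= s <= 1 -> 0 <= w s) -> 0 < w 0 ->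
  0 <= t < 1 -> 0 < linear_solution w t.
Proof.
intros Hw Hpos H0 Ht.
destruct (MVT_gen (linear_solution w) t 1 (fun s => - slope w s)) as [c [Hc HM]].
- intros x _; now apply is_derive_linear_solution.
- intros x _; now apply continuity_pt_filterlim, continuous_linear_solution.
- rewrite Rmin_left, Rmax_right in Hc by lra.
  rewrite linear_solution_1 in HM.
  pose proof (slope_pos w c Hw Hpos H0 ltac:(lra)); nra.
Qed.

End Radial_operator.

(** * Monotone iteration *)

Definition clamp (t : R) : R := Rmax 0 (Rmin 1 t).

Lemma clamp_bounds t : 0 <= clamp t <= 1.
Proof. unfold clamp, Rmax, Rmin; repeat destruct Rle_dec; lra. Qed.

Lemma clamp_id t : 0 <= t <= 1 -> clamp t = t.
Proof. unfold clamp, Rmax, Rmin; repeat destruct Rle_dec; lra. Qed.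

Lemma clamp_lipschitz x y : Rabs (clamp x - clamp y) <= Rabs (x - y).
Proof.
unfold clamp, Rmax, Rmin, Rabs; repeat destruct Rle_dec; repeat destruct Rcase_abs; lra.
Qed.

Lemma continuous_of_lipschitz (g : R -> R) (C : R) :
  (forall x y, Rabs (g x - g y) <= C * Rabs (x - y)) -> forall x, continuous g x.
Proof.
intros Hg x; apply continuity_pt_filterlim; intros eps Heps.
pose proof (Rabs_pos C) as HC.
exists (eps / (Rabs C + 1)); split; [apply Rdiv_lt_0_compat; lra|].
intros y [_ Hy]; simpl in *; unfold Rdist in *.
apply Rle_lt_trans with ((Rabs C + 1) * Rabs (y - x)).
- eapply Rle_trans; [apply Hg|]; apply Rmult_le_compat_r; [apply Rabs_pos|].
  pose proof (Rle_abs C); lra.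
- apply Rlt_div_r in Hy; lra.
Qed.

(* Dini's theorem for equi-Lipschitz functions. *)
Lemma monotone_limit_uniform (g : nat -> R -> R) (h : R -> R) (C : R) :
  (forall n t, g n t <= g (S n) t) ->
  (forall t, is_lim_seq (fun n => g n t) (h t)) ->
  (forall n x y, Rabs (g n x - g n y) <= C * Rabs (x - y)) ->
  (forall x y, Rabs (h x - h y) <= C * Rabs (x - y)) ->
  forall eps, 0 < eps -> exists N, forall t, 0 <= t <= 1 -> h t <= g N t + eps.
Proof.
intros Hincr Hlim Hg Hh eps Heps.
assert (Hmono : forall n p t, (n <= p)%nat -> g n t <= g p t).
{ intros n p t Hnp; induction Hnp; [lra|]; specialize (Hincr m t); lra. }
pose proof (Rabs_pos C) as HC; pose proof (Rle_abs C) as HC'.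
destruct (nfloor_ex (3 * (Rabs C + 1) / eps)) as [p [_ Hp]].
{ apply Rlt_le, Rdiv_lt_0_compat; lra. }
assert (HP : 0 < INR p + 1) by (pose proof (pos_INR p); lra).
(* One index serves all nodes of a mesh of width [1 / (p + 1)]. The error is split in three: one
   third at the node, one third each for moving [h] and [g N] to the node. *)
assert (Hnet : forall j : nat, exists N, forall i, (i <= j)%nat ->
  h (INR i / (INR p + 1)) <= g N (INR i / (INR p + 1)) + eps / 3).
{ assert (H1 : forall x, exists N, h x <= g N x + eps / 3).
  { intros x; pose proof (Hlim x) as Hx; apply is_lim_seq_spec in Hx.
    assert (He : 0 < eps / 3) by lra.
    destruct (Hx (mkposreal _ He)) as [N HN].
    exists N; specialize (HN N (Nat.le_refl N)); simpl in HN; apply Rabs_def2 in HN; lra. }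
  induction j as [|j [N HN]].
  - destruct (H1 (INR 0 / (INR p + 1))) as [N HN]; exists N; intros i Hi.
    now apply Nat.le_0_r in Hi; subst.
  - destruct (H1 (INR (S j) / (INR p + 1))) as [N' HN'].
    exists (Nat.max N N'); intros i Hi; apply Nat.le_succ_r in Hi as [Hi| ->].
    + specialize (HN i Hi).
      pose proof (Hmono N (Nat.max N N') (INR i / (INR p + 1)) (Nat.le_max_l _ _)); lra.
    + pose proof (Hmono N' (Nat.max N N') (INR (S j) / (INR p + 1)) (Nat.le_max_r _ _)); lra. }
destruct (Hnet (S p)) as [N HN].
exists N; intros t Ht.
destruct (nfloor_ex (t * (INR p + 1))) as [j [Hj1 Hj2]]; [nra|].
assert (Hjp : (j <= S p)%nat) by (apply INR_le; rewrite S_INR; nra).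
specialize (HN j Hjp).
set (x := INR j / (INR p + 1)) in *.
assert (Hx : Rabs (t - x) <= eps / (3 * (Rabs C + 1))).
{ replace t with (t * (INR p + 1) / (INR p + 1)) by (field; lra).
  unfold x; replace (t * (INR p + 1) / (INR p + 1) - INR j / (INR p + 1))
    with ((t * (INR p + 1) - INR j) / (INR p + 1)) by (field; lra).
  rewrite Rabs_div by lra.
  rewrite (Rabs_pos_eq (t * (INR p + 1) - INR j)) by lra.
  rewrite (Rabs_pos_eq (INR p + 1)) by lra.
  apply Rle_trans with (1 / (INR p + 1)).
  - apply Rmult_le_compat_r; [apply Rlt_le, Rinv_0_lt_compat; lra|lra].
  - apply Rle_div_l; [lra|].
    apply Rlt_div_l in Hp; [|lra].
    apply Rmult_le_reg_r with (3 * (Rabs C + 1)); [lra|].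
    replace (eps / (3 * (Rabs C + 1)) * (INR p + 1) * (3 * (Rabs C + 1)))
      with ((INR p + 1) * eps) by (field; lra).
    lra. }
assert (HCx : C * Rabs (t - x) <= eps / 3).
{ apply Rle_trans with ((Rabs C + 1) * (eps / (3 * (Rabs C + 1)))).
  - pose proof (Rabs_pos (t - x)); apply Rle_trans with ((Rabs C + 1) * Rabs (t - x)); nra.
  - apply Req_le; field; lra. }
specialize (Hg N t x); specialize (Hh t x).
apply Rabs_le_between in Hg; apply Rabs_le_between in Hh; lra.
Qed.

Section Monotone_iteration.

Variables (a b F : R -> R) (k l : R).
Hypothesis a_cont : forall t, continuous a t.
Hypothesis b_cont : forall t, continuous b t.
Hypothesis F_cont : forall s, continuous F s.
Hypothesis l_pos : 0 < l.
Hypothesis b_nonneg : forall t, 0 <= b t.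
Hypothesis F_pos : forall s, 0 < F s.
Hypothesis F_nondecreasing : forall x y, x <= y -> F x <= F y.

Definition source (g : R -> R) (t : R) : R := b t * F (g t).

Definition picard (g : R -> R) : R -> R := linear_solution a k l (source g).

Lemma continuous_source g t : (forall t, continuous g t) -> continuous (source g) t.
Proof.
intros Hg; apply continuous_mult_R; [apply b_cont|].
apply (continuous_comp g F); [apply Hg|apply F_cont].
Qed.

Lemma source_nonneg g t : 0 <= source g t.
Proof. apply Rmult_le_pos; [apply b_nonneg|apply Rlt_le, F_pos]. Qed.

Lemma source_le g1 g2 t : g1 t <= g2 t -> source g1 t <= source g2 t.
Proof. intros H; apply Rmult_le_compat_l; [apply b_nonneg|now apply F_nondecreasing]. Qed.

Lemma continuous_picard g t : (forall t, continuous g t) -> continuous (picard g) t.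
Proof.
intros Hg; exact (continuous_linear_solution a k l a_cont (source g) t
  (fun s => continuous_source g s Hg)).
Qed.

Lemma picard_nonneg g t : (forall t, continuous g t) -> 0 <= t <= 1 -> 0 <= picard g t.
Proof.
intros Hg Ht; exact (linear_solution_nonneg a k l a_cont l_pos (source g) t
  (fun s => continuous_source g s Hg) (fun s _ => source_nonneg g s) Ht).
Qed.

Lemma picard_le g1 g2 t :
  (forall t, continuous g1 t) -> (forall t, continuous g2 t) -> 0 <= t <= 1 ->
  (forall s, 0 < s < 1 -> g1 s <= g2 s) -> picard g1 t <= picard g2 t.
Proof.
intros H1 H2 Ht Hle; exact (linear_solution_le a k l a_cont l_pos (source g1) (source g2) t
  (fun s => continuous_source g1 s H1) (fun s => continuous_source g2 s H2) Ht
  (fun s Hs => source_le g1 g2 s (Hle s Hs))).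
Qed.

(** [clamp] carries the bounds proved on [0, 1] over to the whole line, where continuity of the
    sources is required. *)
Fixpoint iterate (n : nat) (t : R) : R :=
  match n with
  | O => 0
  | S n => picard (iterate n) (clamp t)
  end.

Variables (ubar : R -> R) (m : R).
Hypothesis ubar_bounds : forall t, 0 <= t < 1 -> 0 <= ubar t <= m.
(** The supersolution enters through the invariance of the set of continuous functions below it. The
    end point 1 is left out because the intended [ubar] is built from [M], which is specified on [0,
    1) only. *)
Hypothesis ubar_supersolution : forall g, (forall t, continuous g t) ->
  (forall t, 0 <= t < 1 -> g t <= ubar t) ->
  forall t, 0 <= t < 1 -> picard g t <= ubar t.

Lemma continuous_clamp t : continuous clamp t.
Proof.
apply (continuous_of_lipschitz clamp 1); intros x y; rewrite Rmult_1_l; apply clamp_lipschitz.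
Qed.

Lemma iterate_S n t : iterate (S n) t = picard (iterate n) (clamp t).
Proof. reflexivity. Qed.

Lemma continuous_iterate n t : continuous (iterate n) t.
Proof.
revert t; induction n as [|n IH]; intros t; [apply (continuous_const 0)|].
apply (continuous_comp clamp (picard (iterate n))); [apply continuous_clamp|].
now apply continuous_picard.
Qed.

Lemma iterate_increasing n t : iterate n t <= iterate (S n) t.
Proof.
revert t; induction n as [|n IH]; intros t; rewrite !iterate_S.
- apply picard_nonneg; [apply continuous_iterate|apply clamp_bounds].
- apply picard_le; [apply continuous_iterate..|apply clamp_bounds|intros; apply IH].
Qed.

Lemma iterate_le_ubar n t : 0 <= t < 1 -> iterate n t <= ubar t.
Proof.
revert t; induction n as [|n IH]; intros t Ht; [now apply ubar_bounds|].
rewrite iterate_S, clamp_id by lra; apply ubar_supersolution; trivial.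
apply continuous_iterate.
Qed.

Lemma iterate_le n t : iterate n t <= m.
Proof.
assert (Hm : 0 <= m) by (pose proof (ubar_bounds 0 ltac:(lra)); lra).
destruct n as [|n]; [exact Hm|rewrite iterate_S].
destruct (clamp_bounds t) as [H0 [H1|H1]].
- pose proof (iterate_le_ubar (S n) (clamp t) ltac:(lra)) as H.
  rewrite iterate_S, (clamp_id (clamp t)) in H by apply clamp_bounds.
  pose proof (ubar_bounds (clamp t) ltac:(lra)); lra.
- rewrite H1; unfold picard; now rewrite linear_solution_1.
Qed.

(** All iterates are at most [m], so their slopes lie between 0 and the slope for the source
    evaluated at the constant [m], which is bounded on [0, 1]. *)
Lemma iterate_lipschitz :
  exists C, forall n x y, Rabs (iterate n x - iterate n y) <= C * Rabs (x - y).
Proof.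
set (w := source (fun _ => m)).
assert (Hw : forall t, continuous w t).
{ intros t; apply continuous_source; intros s; apply (continuous_const m). }
destruct (continuity_ab_maj (slope a k l w) 0 1) as [c [Hc _]]; [lra| |].
{ intros t _; apply continuity_pt_filterlim, continuous_slope; assumption. }
set (C := Rmax 0 (slope a k l w c)).
exists C.
assert (HC : 0 <= C) by apply Rmax_l.
assert (Hlip : forall n x y, 0 <= x <= y -> y <= 1 ->
  Rabs (picard (iterate n) x - picard (iterate n) y) <= C * Rabs (x - y)).
{ intros n x y Hxy Hy.
  set (wn := source (iterate n)).
  assert (Hwn : forall t, continuous wn t).
  { intros t; apply continuous_source; intros s; apply continuous_iterate. }
  assert (H1 : - picard (iterate n) x <= - picard (iterate n) y).
  { apply (nondecreasing_of_derive (fun t => - picard (iterate n) t) (fun t => - - slope a k l wn t));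
      [lra|..].
    - intros t _; apply (is_derive_opp (picard (iterate n))).
      exact (is_derive_linear_solution a k l a_cont wn t Hwn).
    - intros t _; apply (continuous_opp (picard (iterate n))).
      apply continuous_picard, continuous_iterate.
    - intros t Ht; rewrite Ropp_involutive; apply slope_nonneg; trivial; [|lra].
      intros s _; apply source_nonneg. }
  assert (H2 : picard (iterate n) x + C * x <= picard (iterate n) y + C * y).
  { apply (nondecreasing_of_derive (fun t => picard (iterate n) t + C * t)
             (fun t => - slope a k l wn t + C)); [lra|..].
    - intros t _; apply (is_derive_plus (picard (iterate n)) (fun t => C * t)).
      + exact (is_derive_linear_solution a k l a_cont wn t Hwn).
      + auto_derive; [trivial|ring].
    - intros t _; apply continuous_plus_R; [apply continuous_picard, continuous_iterate|].
      apply (ex_derive_continuous (fun t => C * t)); auto_derive; trivial.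
    - intros t Ht.
      assert (slope a k l wn t <= slope a k l w t).
      { apply slope_le; trivial; [lra|]; intros s _.
        apply Rmult_le_compat_l; [apply b_nonneg|].
        apply F_nondecreasing, iterate_le. }
      specialize (Hc t ltac:(lra)).
      pose proof (Rmax_r 0 (slope a k l w c)); fold C in H0; lra. }
  rewrite (Rabs_left1 (x - y)), Rabs_pos_eq by lra; lra. }
intros [|n] x y.
{ unfold iterate; rewrite Rminus_diag, Rabs_R0; apply Rmult_le_pos; [exact HC|apply Rabs_pos]. }
rewrite !iterate_S; apply Rle_trans with (C * Rabs (clamp x - clamp y));
  [|apply Rmult_le_compat_l; [exact HC|apply clamp_lipschitz]].
pose proof (clamp_bounds x); pose proof (clamp_bounds y).
destruct (Rle_or_lt (clamp x) (clamp y)) as [Hxy|Hxy]; [apply Hlip; lra|].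
rewrite Rabs_minus_sym, (Rabs_minus_sym (clamp x)); apply Hlip; lra.
Qed.

(** The limit [g] of the iterates works. Monotonicity alone gives [g <= picard g]. For the converse,
    uniform convergence and uniform continuity of [F] put the source of [g] below that of some
    iterate plus a small multiple of [b]; by linearity [picard g] is then at most the next iterate
    plus [eps]. *)
Lemma exists_fixed_point :
  exists g, (forall t, continuous g t) /\ (forall t, 0 <= g t) /\
    forall t, 0 <= t <= 1 -> picard g t = g t.
Proof.
destruct iterate_lipschitz as [C HC].
assert (Hnn : forall n t, 0 <= iterate n t).
{ intros n t; induction n as [|n IH]; [apply Rle_refl|]; pose proof (iterate_increasing n t); lra. }
set (g := fun t => real (Lim_seq (fun n => iterate n t))).
assert (Hg : forall t, is_lim_seq (fun n => iterate n t) (g t)).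
{ intros t; apply Lim_seq_correct', (ex_finite_lim_seq_incr _ m).
  - intros n; apply iterate_increasing.
  - intros n; apply iterate_le. }
assert (Hgn : forall n t, iterate n t <= g t).
{ intros n t; apply (is_lim_seq_incr_compare (fun n => iterate n t)); [apply Hg|].
  intros p; apply iterate_increasing. }
assert (Hgm : forall t, g t <= m).
{ intros t; apply (is_lim_seq_le (fun n => iterate n t) (fun _ => m) (g t) m);
    [intros n; apply iterate_le|apply Hg|apply is_lim_seq_const]. }
assert (Hlip : forall x y, Rabs (g x - g y) <= C * Rabs (x - y)).
{ intros x y.
  apply (is_lim_seq_le (fun n => Rabs (iterate n x - iterate n y)) (fun _ => C * Rabs (x - y))
           (Rabs (g x - g y)) (C * Rabs (x - y))).
  - intros n; apply HC.
  - apply (is_lim_seq_abs _ (Finite (g x - g y))), is_lim_seq_minus'; apply Hg.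
  - apply is_lim_seq_const. }
assert (Hcont : forall t, continuous g t) by apply (continuous_of_lipschitz g C Hlip).
exists g; split; [exact Hcont|split].
{ intros t; specialize (Hgn O t); exact Hgn. }
assert (Hsrc : forall t, continuous (source g) t) by (intros t; now apply continuous_source).
assert (Hsrcn : forall n t, continuous (source (iterate n)) t).
{ intros n t; apply continuous_source, continuous_iterate. }
intros t Ht; apply Rle_antisym.
- apply le_epsilon; intros eps Heps.
  set (D := linear_solution a k l b t).
  assert (HD : 0 <= D).
  { exact (linear_solution_nonneg a k l a_cont l_pos b t b_cont (fun s _ => b_nonneg s) Ht). }
  assert (He : 0 < eps / (D + 1)) by (apply Rdiv_lt_0_compat; lra).
  assert (HFc : forall x, 0 <= x <= m -> continuity_pt F x).
  { intros x _; apply continuity_pt_filterlim, F_cont. }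
  destruct (Heine_cor2 HFc (mkposreal _ He)) as [d Hd].
  destruct (monotone_limit_uniform iterate g C) with (eps := d / 2) as [N HN]; trivial.
  { apply iterate_increasing. }
  { pose proof (cond_pos d); lra. }
  apply Rle_trans with (linear_solution a k l (fun s => source (iterate N) s + eps / (D + 1) * b s) t).
  + refine (linear_solution_le a k l a_cont l_pos _ _ t Hsrc _ Ht _).
    * intros s; apply continuous_plus_R; [apply Hsrcn|].
      apply continuous_mult_R; [apply continuous_const|apply b_cont].
    * intros s Hs; unfold source.
      assert (F (g s) <= F (iterate N s) + eps / (D + 1)).
      { assert (HF : Rabs (F (g s) - F (iterate N s)) < eps / (D + 1)).
        { apply Hd.
          - split; [apply Rle_trans with (iterate N s); [apply Hnn|apply Hgn]|apply Hgm].
          - split; [apply Hnn|apply iterate_le].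
          - specialize (HN s ltac:(lra)); pose proof (Hgn N s); pose proof (cond_pos d).
            apply Rabs_def1; lra. }
        apply Rabs_def2 in HF; lra. }
      pose proof (b_nonneg s); nra.
  + rewrite (linear_solution_lincomb a k l a_cont (source (iterate N)) b _ t (Hsrcn N) b_cont).
    fold D.
    assert (Hit : linear_solution a k l (source (iterate N)) t = iterate (S N) t).
    { now rewrite iterate_S, clamp_id. }
    rewrite Hit; pose proof (Hgn (S N) t).
    assert (eps / (D + 1) * D <= eps).
    { apply Rmult_le_reg_r with (D + 1); [lra|].
      replace (eps / (D + 1) * D * (D + 1)) with (eps * D) by (field; lra); nra. }
    lra.
- apply (is_lim_seq_le (fun n => iterate (S n) t) (fun _ => picard g t) (g t) (picard g t)).
  + intros n; rewrite iterate_S, clamp_id by exact Ht.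
    apply picard_le; [apply continuous_iterate|exact Hcont|exact Ht|intros s _; apply Hgn].
  + apply (is_lim_seq_incr_1 (fun n => iterate n t)), Hg.
  + apply is_lim_seq_const.
Qed.

End Monotone_iteration.

(** * Radial functions in the plane *)

Lemma rad_sqr x y : rad x y ^ 2 = x ^ 2 + y ^ 2.
Proof.
unfold rad; rewrite pow2_sqrt; [reflexivity|].
pose proof (pow2_ge_0 x); pose proof (pow2_ge_0 y); lra.
Qed.

Lemma rad_nonneg x y : 0 <= rad x y.
Proof. apply sqrt_pos. Qed.

Lemma rad_lt x y r : 0 < r -> x ^ 2 + y ^ 2 < r ^ 2 -> rad x y < r.
Proof. intros Hr H; rewrite <- rad_sqr in H; pose proof (rad_nonneg x y); nra. Qed.

Lemma rad_radial_derivative u x y :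
  rad x y * radial_derivative u x y
  = x * partial_derive 1 0 u x y + y * partial_derive 0 1 u x y.
Proof.
unfold radial_derivative.
destruct (Req_dec (rad x y) 0) as [H0|H0]; [|now field].
pose proof (rad_sqr x y) as H; rewrite H0 in H.
pose proof (pow2_ge_0 x); pose proof (pow2_ge_0 y).
assert (x = 0) by nra; assert (y = 0) by nra; subst; rewrite H0; ring.
Qed.

Lemma continuous_2d_comp (g : R -> R) (h : R -> R -> R) x y :
  continuous g (h x y) -> continuity_2d_pt h x y -> continuity_2d_pt (fun x y => g (h x y)) x y.
Proof. intros Hg; apply continuity_1d_2d_pt_comp; now apply continuity_pt_filterlim. Qed.

Lemma continuity_2d_sqr_sum x y : continuity_2d_pt (fun x y => x ^ 2 + y ^ 2) x y.
Proof.
apply continuity_2d_pt_plus; simpl; repeat apply continuity_2d_pt_mult;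
  (apply continuity_2d_pt_id1 || apply continuity_2d_pt_id2 || apply continuity_2d_pt_const).
Qed.

Lemma sqr_sum_eq0 x y : x ^ 2 + y ^ 2 = 0 -> x = 0 /\ y = 0.
Proof. intros H; split; nra. Qed.

(* The quotient by [x^2 + y^2] is [0] at the origin by convention; continuity there
   comes from [h 0 = 0] and the boundedness of [p]. *)
Lemma continuity_2d_homogeneous (p : R -> R -> R) (h : R -> R) x y :
  (forall x y, continuity_2d_pt p x y) ->
  (forall x y, Rabs (p x y) <= x ^ 2 + y ^ 2) ->
  (forall t, continuous h t) -> h 0 = 0 ->
  continuity_2d_pt (fun x y => p x y / (x ^ 2 + y ^ 2) * h (x ^ 2 + y ^ 2)) x y.
Proof.
intros Hp Hb Hh H0.
assert (Hhc : continuity_2d_pt (fun x y => h (x ^ 2 + y ^ 2)) x y).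
{ apply continuous_2d_comp; [apply Hh|apply continuity_2d_sqr_sum]. }
destruct (Req_dec (x ^ 2 + y ^ 2) 0) as [Hz|Hz].
- intros eps; destruct (Hhc eps) as [d Hd]; exists d; intros u v Hu Hv.
  specialize (Hd u v Hu Hv); rewrite Hz, H0, Rminus_0_r in *.
  rewrite Rmult_0_r, Rminus_0_r.
  eapply Rle_lt_trans; [|exact Hd].
  apply Rle_trans with (1 * Rabs (h (u ^ 2 + v ^ 2))); [rewrite Rabs_mult|lra].
  apply Rmult_le_compat_r; [apply Rabs_pos|].
  destruct (Req_dec (u ^ 2 + v ^ 2) 0) as [Hz'|Hz'].
  + rewrite Hz'; unfold Rdiv; rewrite Rinv_0, Rmult_0_r, Rabs_R0; lra.
  + assert (0 < u ^ 2 + v ^ 2) by (pose proof (pow2_ge_0 u); pose proof (pow2_ge_0 v); lra).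
    rewrite Rabs_div, (Rabs_pos_eq (u ^ 2 + v ^ 2)) by lra.
    apply Rle_div_l; [lra|]; specialize (Hb u v); lra.
- apply continuity_2d_pt_mult; [|exact Hhc].
  apply continuity_2d_pt_mult; [apply Hp|].
  apply continuity_2d_pt_inv; [apply continuity_2d_sqr_sum|exact Hz].
Qed.

(** Continuity of [h] suffices. This gives the second derivatives at the origin, where [slope] is
    only known to be continuous. *)
Lemma is_derive_id_mult (h : R -> R) : continuous h 0 -> is_derive (fun x => x * h x) 0 (h 0).
Proof.
intros Hh; apply is_derive_Reals; intros eps Heps.
apply continuity_pt_filterlim in Hh; destruct (Hh eps Heps) as [d [Hd Hlim]].
exists (mkposreal d Hd); intros x Hx Hxd; simpl in *; unfold Rdist in *.
replace ((0 + x) * h (0 + x) - 0 * h 0) with (x * h x) by (rewrite Rplus_0_l; ring).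
replace (x * h x / x) with (h x) by now field.
apply Hlim; split; [split; [exact I|now apply not_eq_sym]|now rewrite Rminus_0_r].
Qed.

Section Radial_function.

Variables (a w : R -> R) (k l : R).
Hypothesis a_cont : forall t, continuous a t.
Hypothesis w_cont : forall t, continuous w t.
Hypothesis l_pos : 0 < l.

Let q := slope a k l w.

(** This is [t * q' t], by [is_derive_slope]. Unlike [q'] it is continuous at 0, and it is the
    combination that appears in all second derivatives of the lift. *)
Definition slope_defect (t : R) : R := l * w t - k * a t * t * q t - q t.

Definition radial_lift (x y : R) : R := linear_solution a k l w (x ^ 2 + y ^ 2).

Lemma continuous_slope_defect t : continuous slope_defect t.
Proof.
apply continuous_plus_R; [apply continuous_plus_R|].
- apply continuous_mult_R; [apply continuous_const|apply w_cont].
- apply (continuous_opp (fun t => k * a t * t * q t)).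
  apply continuous_mult_R; [|now apply continuous_slope].
  apply continuous_mult_R; [|apply continuous_id].
  apply continuous_mult_R; [apply continuous_const|apply a_cont].
- apply (continuous_opp q); now apply continuous_slope.
Qed.

Lemma slope_defect_0 : slope_defect 0 = 0.
Proof. unfold slope_defect, q; rewrite slope_at_0; ring. Qed.

Lemma radial_lift_sym x y : radial_lift x y = radial_lift y x.
Proof. unfold radial_lift; f_equal; ring. Qed.

Lemma is_derive_radial_lift x y :
  is_derive (fun x => radial_lift x y) x (-2 * x * q (x ^ 2 + y ^ 2)).
Proof.
replace (-2 * x * q (x ^ 2 + y ^ 2)) with (scal (2 * x) (- q (x ^ 2 + y ^ 2)))
  by (unfold scal; simpl; unfold mult; simpl; ring).
apply (is_derive_comp (linear_solution a k l w) (fun x => x ^ 2 + y ^ 2)).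
- now apply is_derive_linear_solution.
- auto_derive; [trivial|ring].
Qed.

Lemma is_derive_radial_lift_xx x y :
  is_derive (fun x => -2 * x * q (x ^ 2 + y ^ 2)) x
    (-2 * q (x ^ 2 + y ^ 2) - 4 * (x ^ 2 / (x ^ 2 + y ^ 2) * slope_defect (x ^ 2 + y ^ 2))).
Proof.
destruct (Req_dec (x ^ 2 + y ^ 2) 0) as [Hz|Hz].
- destruct (sqr_sum_eq0 x y Hz) as [-> ->].
  apply (is_derive_ext (fun x => x * (-2 * q (x ^ 2 + 0 ^ 2)))).
  { intros t; simpl; ring. }
  replace (-2 * q (0 ^ 2 + 0 ^ 2) - 4 * (0 ^ 2 / (0 ^ 2 + 0 ^ 2) * slope_defect (0 ^ 2 + 0 ^ 2)))
    with (-2 * q (0 ^ 2 + 0 ^ 2)) by (unfold Rdiv; ring).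
  apply (is_derive_id_mult (fun x => -2 * q (x ^ 2 + 0 ^ 2))).
  apply continuous_mult_R; [apply continuous_const|].
  apply (continuous_comp (fun x => x ^ 2 + 0 ^ 2) q); [|now apply continuous_slope].
  apply (ex_derive_continuous (fun x => x ^ 2 + 0 ^ 2)); auto_derive; trivial.
- assert (Hq : is_derive (fun x => q (x ^ 2 + y ^ 2)) x
     (2 * x * (slope_defect (x ^ 2 + y ^ 2) / (x ^ 2 + y ^ 2)))).
  { apply (is_derive_comp q (fun x => x ^ 2 + y ^ 2)).
    - now apply is_derive_slope.
    - auto_derive; [trivial|ring]. }
  replace (-2 * q (x ^ 2 + y ^ 2) - 4 * (x ^ 2 / (x ^ 2 + y ^ 2) * slope_defect (x ^ 2 + y ^ 2)))
    with (-2 * q (x ^ 2 + y ^ 2)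
          + -2 * x * (2 * x * (slope_defect (x ^ 2 + y ^ 2) / (x ^ 2 + y ^ 2)))) by now field.
  apply (is_derive_mult (fun x => -2 * x) (fun x => q (x ^ 2 + y ^ 2))); [|exact Hq|].
  + auto_derive; [trivial|ring].
  + intros; apply Rmult_comm.
Qed.

Lemma is_derive_radial_lift_xy x y :
  is_derive (fun y => -2 * x * q (x ^ 2 + y ^ 2)) y
    (-4 * (x * y / (x ^ 2 + y ^ 2) * slope_defect (x ^ 2 + y ^ 2))).
Proof.
destruct (Req_dec (x ^ 2 + y ^ 2) 0) as [Hz|Hz].
- destruct (sqr_sum_eq0 x y Hz) as [-> ->].
  apply (is_derive_ext (fun _ => 0)); [intros t; simpl; ring|].
  replace (-4 * (0 * 0 / (0 ^ 2 + 0 ^ 2) * slope_defect (0 ^ 2 + 0 ^ 2))) with 0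
    by (unfold Rdiv; ring).
  apply (is_derive_const (V := R_NormedModule)).
- replace (-4 * (x * y / (x ^ 2 + y ^ 2) * slope_defect (x ^ 2 + y ^ 2)))
    with (-2 * x * (2 * y * (slope_defect (x ^ 2 + y ^ 2) / (x ^ 2 + y ^ 2)))) by now field.
  apply (is_derive_scal (fun y => q (x ^ 2 + y ^ 2))).
  apply (is_derive_comp q (fun y => x ^ 2 + y ^ 2)).
  + now apply is_derive_slope.
  + auto_derive; [trivial|ring].
Qed.

Lemma is_derive_radial_lift_y x y :
  is_derive (fun y => radial_lift x y) y (-2 * y * q (x ^ 2 + y ^ 2)).
Proof.
rewrite (Rplus_comm (x ^ 2)).
apply (is_derive_ext (fun y => radial_lift y x)); [intros; apply radial_lift_sym|].
apply is_derive_radial_lift.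
Qed.

Lemma is_derive_radial_lift_yy x y :
  is_derive (fun y => -2 * y * q (x ^ 2 + y ^ 2)) y
    (-2 * q (x ^ 2 + y ^ 2) - 4 * (y ^ 2 / (x ^ 2 + y ^ 2) * slope_defect (x ^ 2 + y ^ 2))).
Proof.
rewrite (Rplus_comm (x ^ 2)).
apply (is_derive_ext (fun y => -2 * y * q (y ^ 2 + x ^ 2))).
{ intros t; now rewrite (Rplus_comm (x ^ 2)). }
apply is_derive_radial_lift_xx.
Qed.

Lemma is_derive_radial_lift_yx x y :
  is_derive (fun x => -2 * y * q (x ^ 2 + y ^ 2)) x
    (-4 * (x * y / (x ^ 2 + y ^ 2) * slope_defect (x ^ 2 + y ^ 2))).
Proof.
rewrite (Rplus_comm (x ^ 2)), (Rmult_comm x).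
apply (is_derive_ext (fun x => -2 * y * q (y ^ 2 + x ^ 2))).
{ intros t; now rewrite (Rplus_comm (t ^ 2)). }
apply is_derive_radial_lift_xy.
Qed.

Lemma continuity_2d_radial (h : R -> R) x y :
  (forall t, continuous h t) -> continuity_2d_pt (fun x y => h (x ^ 2 + y ^ 2)) x y.
Proof. intros Hh; apply continuous_2d_comp; [apply Hh|apply continuity_2d_sqr_sum]. Qed.

Lemma ex_diff_2_radial_lift x y : ex_diff_n radial_lift 2 x y.
Proof.
assert (Hq : forall x y, continuity_2d_pt (fun x y => q (x ^ 2 + y ^ 2)) x y).
{ intros; apply continuity_2d_radial; intros; now apply continuous_slope. }
(* [ex_diff_n] speaks of the derivatives as functions, so each of them is replaced by its closed
   form as a function. *)
assert (Hdx : (fun u v => Derive (fun z => radial_lift z v) u)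
              = fun u v => -2 * u * q (u ^ 2 + v ^ 2)).
{ do 2 (apply functional_extensionality; intro); apply is_derive_unique, is_derive_radial_lift. }
assert (Hdy : (fun u v => Derive (fun z => radial_lift u z) v)
              = fun u v => -2 * v * q (u ^ 2 + v ^ 2)).
{ do 2 (apply functional_extensionality; intro); apply is_derive_unique, is_derive_radial_lift_y. }
assert (Hxx : (fun u v => Derive (fun z => -2 * z * q (z ^ 2 + v ^ 2)) u)
  = fun u v => -2 * q (u ^ 2 + v ^ 2)
               - 4 * (u ^ 2 / (u ^ 2 + v ^ 2) * slope_defect (u ^ 2 + v ^ 2))).
{ do 2 (apply functional_extensionality; intro); apply is_derive_unique, is_derive_radial_lift_xx. }
assert (Hxy : (fun u v => Derive (fun z => -2 * u * q (u ^ 2 + z ^ 2)) v)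
  = fun u v => -4 * (u * v / (u ^ 2 + v ^ 2) * slope_defect (u ^ 2 + v ^ 2))).
{ do 2 (apply functional_extensionality; intro); apply is_derive_unique, is_derive_radial_lift_xy. }
assert (Hyx : (fun u v => Derive (fun z => -2 * v * q (z ^ 2 + v ^ 2)) u)
  = fun u v => -4 * (u * v / (u ^ 2 + v ^ 2) * slope_defect (u ^ 2 + v ^ 2))).
{ do 2 (apply functional_extensionality; intro); apply is_derive_unique, is_derive_radial_lift_yx. }
assert (Hyy : (fun u v => Derive (fun z => -2 * z * q (u ^ 2 + z ^ 2)) v)
  = fun u v => -2 * q (u ^ 2 + v ^ 2)
               - 4 * (v ^ 2 / (u ^ 2 + v ^ 2) * slope_defect (u ^ 2 + v ^ 2))).
{ do 2 (apply functional_extensionality; intro); apply is_derive_unique, is_derive_radial_lift_yy. }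
assert (Hhom : forall p, (forall x y, continuity_2d_pt p x y) ->
  (forall x y, Rabs (p x y) <= x ^ 2 + y ^ 2) ->
  continuity_2d_pt (fun x y => p x y / (x ^ 2 + y ^ 2) * slope_defect (x ^ 2 + y ^ 2)) x y).
{ intros p Hp Hb; apply continuity_2d_homogeneous; trivial;
    [apply continuous_slope_defect|apply slope_defect_0]. }
assert (Cx : forall x y, continuity_2d_pt (fun u _ => u) x y) by apply continuity_2d_pt_id1.
assert (Cy : forall x y, continuity_2d_pt (fun _ v => v) x y) by apply continuity_2d_pt_id2.
assert (Cc : forall c x y, continuity_2d_pt (fun _ _ => c) x y)
  by (intros; apply continuity_2d_pt_const).
assert (Kxx : continuity_2d_pt (fun x y => x ^ 2 / (x ^ 2 + y ^ 2) * slope_defect (x ^ 2 + y ^ 2)) x y).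
{ apply (Hhom (fun x y => x ^ 2)).
  - intros; simpl; repeat apply continuity_2d_pt_mult; trivial.
  - intros u v; rewrite Rabs_pos_eq by apply pow2_ge_0; pose proof (pow2_ge_0 v); lra. }
assert (Kyy : continuity_2d_pt (fun x y => y ^ 2 / (x ^ 2 + y ^ 2) * slope_defect (x ^ 2 + y ^ 2)) x y).
{ apply (Hhom (fun x y => y ^ 2)).
  - intros; simpl; repeat apply continuity_2d_pt_mult; trivial.
  - intros u v; rewrite Rabs_pos_eq by apply pow2_ge_0; pose proof (pow2_ge_0 u); lra. }
assert (Kxy : continuity_2d_pt (fun x y => x * y / (x ^ 2 + y ^ 2) * slope_defect (x ^ 2 + y ^ 2)) x y).
{ apply (Hhom (fun x y => x * y)).
  - intros; apply continuity_2d_pt_mult; trivial.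
  - intros u v; apply Rabs_le; nra. }
split; [|split; [|split; [|split]]].
- apply continuity_2d_radial; intros; now apply continuous_linear_solution.
- eexists; apply is_derive_radial_lift.
- eexists; apply is_derive_radial_lift_y.
- rewrite Hdx; split; [|split; [|split; [|split]]].
  + repeat apply continuity_2d_pt_mult; trivial.
  + eexists; apply is_derive_radial_lift_xx.
  + eexists; apply is_derive_radial_lift_xy.
  + rewrite Hxx; split; [|trivial].
    apply continuity_2d_pt_minus; apply continuity_2d_pt_mult; trivial.
  + rewrite Hxy; split; [|trivial].
    apply continuity_2d_pt_mult; trivial.
- rewrite Hdy; split; [|split; [|split; [|split]]].
  + repeat apply continuity_2d_pt_mult; trivial.
  + eexists; apply is_derive_radial_lift_yx.
  + eexists; apply is_derive_radial_lift_yy.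
  + rewrite Hyx; split; [|trivial].
    apply continuity_2d_pt_mult; trivial.
  + rewrite Hyy; split; [|trivial].
    apply continuity_2d_pt_minus; apply continuity_2d_pt_mult; trivial.
Qed.

Lemma laplacian_radial_lift x y :
  laplacian radial_lift x y
  = -4 * q (x ^ 2 + y ^ 2) - 4 * slope_defect (x ^ 2 + y ^ 2).
Proof.
unfold laplacian.
assert (H20 : partial_derive 2 0 radial_lift x y = -2 * q (x ^ 2 + y ^ 2)
               - 4 * (x ^ 2 / (x ^ 2 + y ^ 2) * slope_defect (x ^ 2 + y ^ 2))).
{ change (Derive (fun x => Derive (fun x => radial_lift x y) x) x
    = -2 * q (x ^ 2 + y ^ 2)
      - 4 * (x ^ 2 / (x ^ 2 + y ^ 2) * slope_defect (x ^ 2 + y ^ 2))).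
  rewrite (Derive_ext _ (fun x => -2 * x * q (x ^ 2 + y ^ 2))).
  - apply is_derive_unique, is_derive_radial_lift_xx.
  - intros; apply is_derive_unique, is_derive_radial_lift. }
assert (H02 : partial_derive 0 2 radial_lift x y = -2 * q (x ^ 2 + y ^ 2)
               - 4 * (y ^ 2 / (x ^ 2 + y ^ 2) * slope_defect (x ^ 2 + y ^ 2))).
{ change (Derive (fun y => Derive (fun y => radial_lift x y) y) y
    = -2 * q (x ^ 2 + y ^ 2)
      - 4 * (y ^ 2 / (x ^ 2 + y ^ 2) * slope_defect (x ^ 2 + y ^ 2))).
  rewrite (Derive_ext _ (fun y => -2 * y * q (x ^ 2 + y ^ 2))).
  - apply is_derive_unique, is_derive_radial_lift_yy.
  - intros; apply is_derive_unique, is_derive_radial_lift_y. }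
rewrite H20, H02.
(* At the origin the two quotients are 0 by convention and do not add up to 1; they are multiplied
   by [slope_defect 0 = 0]. *)
destruct (Req_dec (x ^ 2 + y ^ 2) 0) as [Hz|Hz]; [|now field].
rewrite Hz, slope_defect_0; ring.
Qed.

End Radial_function.

(** * From a radial fixed point to a classical solution *)

Lemma continuous_on_unit_interval (g c : R -> R) (t : R) :
  lipschitz_on unit_interval g -> (forall t, unit_interval (c t)) ->
  continuous c t -> continuous (fun t => g (c t)) t.
Proof.
intros [L HL] Hc Hct; apply continuity_pt_filterlim.
apply continuity_pt_filterlim in Hct; intros eps Heps.
pose proof (Rabs_pos L).
destruct (Hct (eps / (Rabs L + 1))) as [d [Hd Hlim]]; [apply Rdiv_lt_0_compat; lra|].
exists d; split; [exact Hd|]; intros x Hx; specialize (Hlim x Hx); simpl in *; unfold Rdist in *.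
apply Rlt_div_r in Hlim; [|lra].
eapply Rle_lt_trans; [apply HL; apply Hc|].
pose proof (Rle_abs L); pose proof (Rabs_pos (c x - c t)); nra.
Qed.

(** [phi] and [psi] are constrained on [0, 1] only; truncating at 1, with [sqrt] being 0 at negative
    arguments, makes [phi (radius t)] and [psi (radius t)] continuous on the whole line. *)
Definition radius (t : R) : R := Rmin 1 (sqrt t).

Lemma radius_bounds t : unit_interval (radius t).
Proof.
pose proof (sqrt_pos t); unfold unit_interval, radius, Rmin; destruct Rle_dec; lra.
Qed.

Lemma continuous_radius t : continuous radius t.
Proof.
apply (continuous_comp sqrt (Rmin 1)); [apply continuous_sqrt|].
apply (continuous_of_lipschitz (Rmin 1) 1); intros x y; rewrite Rmult_1_l.
unfold Rmin, Rabs; repeat destruct Rle_dec; repeat destruct Rcase_abs; lra.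
Qed.

Lemma radius_sqrt t : t <= 1 -> radius t = sqrt t.
Proof.
intros Ht; apply Rmin_right; rewrite <- sqrt_1; now apply sqrt_le_1_alt.
Qed.

Lemma radius_rad x y : disk x y -> radius (x ^ 2 + y ^ 2) = rad x y.
Proof.
intros Hd; apply Rmin_right, Rlt_le, Hd.
Qed.

(** For [u = g(t)] with [t = r^2] the Laplacian is [4 (t g')'] and [r * du/dr] is [2 t g'], hence
    the parameters [al / 2] and [lam / 4]. All coefficients are extended continuously, so the lift
    is of class C^2 in the whole plane and continuity up to the circle is immediate. *)
Lemma fixed_point_solution (f F phi psi g : R -> R) (lam al : R) :
  (forall s, continuous F s) -> (forall s, 0 < F s) -> (forall s, 0 <= s -> F s = f s) ->
  lipschitz_on unit_interval phi -> lipschitz_on unit_interval psi ->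
  (forall r, 0 <= r <= 1 -> 0 <= psi r) -> psi 0 = 1 -> 0 < lam ->
  (forall t, continuous g t) -> (forall t, 0 <= g t) ->
  (forall t, 0 <= t <= 1 ->
     picard (fun t => phi (radius t)) (fun t => psi (radius t)) F (al / 2) (lam / 4) g t = g t) ->
  exists u, classical_solution f phi psi lam al u.
Proof.
intros HF HFpos HFf Hphi Hpsi Hpsi0 Hpsi1 Hlam Hg Hgpos Hfix.
set (a := fun t => phi (radius t)); set (b := fun t => psi (radius t)).
fold a b in Hfix.
assert (Ha : forall t, continuous a t).
{ intros t; apply (continuous_on_unit_interval phi radius); trivial;
    [apply radius_bounds|apply continuous_radius]. }
assert (Hb : forall t, continuous b t).
{ intros t; apply (continuous_on_unit_interval psi radius); trivial;
    [apply radius_bounds|apply continuous_radius]. }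
set (w := source b F g).
assert (Hw : forall t, continuous w t) by (intros t; now apply continuous_source).
assert (Hb0 : forall t, 0 <= b t) by (intros t; apply Hpsi0, radius_bounds).
assert (Hw0 : forall t, 0 <= w t).
{ intros t; apply Rmult_le_pos; [apply Hb0|apply Rlt_le, HFpos]. }
assert (Hw00 : 0 < w 0).
{ apply Rmult_lt_0_compat; [|apply HFpos].
  unfold b, radius; rewrite sqrt_0, Rmin_right, Hpsi1; lra. }
assert (Hl : 0 < lam / 4) by lra.
assert (Ht : forall x y, disk x y -> 0 <= x ^ 2 + y ^ 2 < 1).
{ intros x y Hd; unfold disk in Hd; rewrite <- rad_sqr; pose proof (rad_nonneg x y); nra. }
exists (radial_lift a w (al / 2) (lam / 4)).
split; [|split; [|split; [|split]]].
- intros x y _; now apply ex_diff_2_radial_lift.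
- intros [x y] _.
  apply (filterlim_filter_le_1 (F := locally (x, y))).
  { apply filter_le_within. }
  apply (continuity_2d_pt_filterlim (radial_lift a w (al / 2) (lam / 4)) x y).
  now apply (ex_diff_2_radial_lift a w (al / 2) (lam / 4)).
- intros x y Hd.
  specialize (Ht x y Hd).
  (* Brings the factor [rad] next to [radial_derivative]: their product has a formula that also
     holds at the origin. *)
  rewrite (Rmult_assoc al), (Rmult_comm (rad x y)), <- Rmult_assoc, Rmult_assoc.
  rewrite rad_radial_derivative, laplacian_radial_lift by trivial.
  assert (H10 : partial_derive 1 0 (radial_lift a w (al / 2) (lam / 4)) x y
    = -2 * x * slope a (al / 2) (lam / 4) w (x ^ 2 + y ^ 2)).
  { apply is_derive_unique, is_derive_radial_lift; trivial. }
  assert (H01 : partial_derive 0 1 (radial_lift a w (al / 2) (lam / 4)) x y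
    = -2 * y * slope a (al / 2) (lam / 4) w (x ^ 2 + y ^ 2)).
  { apply is_derive_unique, is_derive_radial_lift_y; trivial. }
  rewrite H10, H01.
  assert (HU : radial_lift a w (al / 2) (lam / 4) x y = g (x ^ 2 + y ^ 2)).
  { refine (Hfix (x ^ 2 + y ^ 2) _); lra. }
  rewrite HU, <- HFf by apply Hgpos.
  unfold slope_defect; rewrite <- (radius_rad x y Hd).
  fold (a (x ^ 2 + y ^ 2)) (b (x ^ 2 + y ^ 2)).
  unfold w at 2, source; field.
- intros x y Hd.
  exact (linear_solution_pos a (al / 2) (lam / 4) Ha Hl w _ Hw (fun s _ => Hw0 s) Hw00 (Ht x y Hd)).
- intros x y Hd; unfold radial_lift; rewrite <- rad_sqr, Hd, pow1.
  apply linear_solution_1.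
Qed.

(** * Inequalities for the supersolution *)

Section Barrier_inequalities.

(* Here [s] stands for the radius [r], [a] for [phi r], [m] for the slowly growing factor
   [1 + B * Mint r], [N] for [M r] and [fp] for [f'] at the supersolution; [k0] and [dR] are
   the [t]-dependent part of the cutoff and the derivative of [R], with [t = s^2]. *)
Variables (th rho al C D mu : R).
Let A3 := (1 + th) ^ 3.
Let c := th / al.
Let Q := A3 / rho ^ 2 + D / (2 * rho).
Let B := 2 * C * Q * mu.
Hypothesis th_bounds : 0 < th <= 1.
Hypothesis rho_bounds : 0 < rho < 1.
Hypothesis C_pos : 0 < C.
Hypothesis D_def : D = 2 * (1 + th) ^ 2 / rho ^ 2.
Hypothesis al_large : 1 <= al * rho ^ 2.
Hypothesis mu_bounds : 0 < mu <= th ^ 2 / (8 * C * (8 + D)).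

Lemma alpha_ge1 : 1 <= al.
Proof. assert (rho ^ 2 <= 1) by nra; assert (0 < rho ^ 2) by nra; nra. Qed.

Lemma core_bounds : 0 < c <= th * rho ^ 2 /\ c <= 1.
Proof.
pose proof alpha_ge1.
assert (0 < c) by (apply Rdiv_lt_0_compat; lra).
assert (c <= th * rho ^ 2) by (apply Rle_div_l; [lra|nra]).
repeat split; trivial; assert (rho ^ 2 <= 1) by nra; nra.
Qed.

Lemma drop_coef_pos : 0 < D.
Proof. rewrite D_def; apply Rdiv_lt_0_compat; nra. Qed.

Lemma log_coef_bounds : 0 < A3 <= 8.
Proof.
unfold A3; split; [apply pow_lt; lra|].
replace 8 with (2 ^ 3) by ring; apply pow_incr; lra.
Qed.

Variables (s a m N fp : R).
Hypothesis s_bounds : 0 < s < 1.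
Hypothesis a_bounds : 0 <= a <= 1.
Hypothesis m_bounds : 1 <= m <= 1 + th.
Hypothesis N_ge1 : 1 <= N.
Hypothesis fp_bounds : 0 <= fp <= C.
Hypothesis inner : s <= rho -> 1 / 2 <= a /\ N <= 1 + th.

Let dR := A3 / (s ^ 2 + c) + D * (N / (2 * s)).
Let k0 := (1 + th) * (s ^ 2 / (s ^ 2 + c)).
Let dk0 := (1 + th) * (c / (s ^ 2 + c) ^ 2).

(** Inside radius [rho] the logarithm dominates, since [N], [1 + th] and [m] are each at most
    [1 + th]. Outside, [N] may be large and the term with [D] dominates; this dictates the value of
    [D]. *)
Lemma barrier_slope_bound : N * ((1 + th) * m / (s ^ 2 + c)) <= dR.
Proof.
destruct core_bounds as [[Hc _] _]; pose proof drop_coef_pos as HD; pose proof log_coef_bounds.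
assert (Hs2 : 0 < s ^ 2) by nra.
assert (HDN : 0 < N / (2 * s)) by (apply Rdiv_lt_0_compat; lra).
unfold dR; destruct (Rle_or_lt s rho) as [Hs|Hs].
- destruct (inner Hs) as [_ HN].
  assert (N * ((1 + th) * m / (s ^ 2 + c)) <= A3 / (s ^ 2 + c)).
  { unfold Rdiv; rewrite <- Rmult_assoc; apply Rmult_le_compat_r;
      [apply Rlt_le, Rinv_0_lt_compat; lra|].
    unfold A3; replace ((1 + th) ^ 3) with ((1 + th) * ((1 + th) * (1 + th))) by ring.
    apply Rmult_le_compat; nra. }
  assert (0 < D * (N / (2 * s))) by (apply Rmult_lt_0_compat; lra); lra.
- assert (N * ((1 + th) * m / (s ^ 2 + c)) <= D * (N / (2 * s))).
  { apply Rle_trans with (N * ((1 + th) ^ 2 / rho ^ 2)).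
    - apply Rmult_le_compat_l; [lra|].
      assert (0 < rho ^ 2) by nra.
      apply Rle_div_l; [lra|].
      apply Rle_trans with ((1 + th) ^ 2 / rho ^ 2 * rho ^ 2).
      + replace ((1 + th) ^ 2 / rho ^ 2 * rho ^ 2) with ((1 + th) * (1 + th)) by (field; lra); nra.
      + apply Rmult_le_compat_l; [apply Rdiv_le_0_compat; nra|nra].
    - rewrite D_def.
      replace (2 * (1 + th) ^ 2 / rho ^ 2 * (N / (2 * s)))
        with (N * ((1 + th) ^ 2 / rho ^ 2) * / s) by (field; lra).
      assert (1 <= / s) by (rewrite <- Rinv_1; apply Rinv_le_contravar; lra).
      assert (0 <= N * ((1 + th) ^ 2 / rho ^ 2)).
      { apply Rmult_le_pos; [lra|]; apply Rdiv_le_0_compat; nra. }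
      nra. }
  assert (0 < A3 / (s ^ 2 + c)) by (apply Rdiv_lt_0_compat; lra); lra.
Qed.

(* Complete the square in [x = c / (s^2 + c)]. *)
Lemma inner_gain : s <= rho -> a + th / 4 <= a * k0 + 2 / al * dk0.
Proof.
intros Hs; destruct (inner Hs) as [Ha _]; destruct core_bounds as [[Hc _] _]; pose proof alpha_ge1.
assert (Hs2 : 0 < s ^ 2) by nra.
set (x := c / (s ^ 2 + c)).
assert (Hx : 0 < x) by (apply Rdiv_lt_0_compat; lra).
replace k0 with ((1 + th) * (1 - x)) by (unfold k0, x; field; lra).
replace (2 / al * dk0) with ((1 + th) * (2 / th * x ^ 2)).
2: { unfold dk0, x; replace al with (th / c) by (unfold c; field; lra); field; lra. }
assert (Hq : 0 <= 2 / th * (x - th / 4) ^ 2).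
{ apply Rmult_le_pos; [apply Rdiv_le_0_compat; lra|apply pow2_ge_0]. }
replace (2 / th * (x - th / 4) ^ 2) with (2 / th * x ^ 2 - x + th / 8) in Hq by (field; lra).
assert (Hx2 : 0 <= 2 / th * x ^ 2).
{ apply Rmult_le_pos; [apply Rdiv_le_0_compat; lra|apply pow2_ge_0]. }
set (X := 2 / th * x ^ 2) in *.
assert (a * X <= X) by nra.
assert (a * (1 - th / 8) <= a * (1 - x + X)) by nra.
assert ((1 + th) * (a * (1 - th / 8)) <= (1 + th) * (a * (1 - x) + X)) by nra.
assert (0 <= a * (th / 2)) by nra.
assert (a * (1 + th / 2) <= (1 + th) * (a * (1 - th / 8))).
{ assert (0 <= a * (th * (3 / 8 - th / 8))) by (apply Rmult_le_pos; nra); nra. }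
nra.
Qed.

(** The product [k0 * dR] is of order [1 / c = al / th], which cancels the factor [1 / al]. What
    remains is small by the bound on [mu], in which 8 stands for [(1 + th)^3]. *)
Lemma inner_loss : s <= rho -> mu / al * fp * k0 * dR <= th / 4.
Proof.
intros Hs; destruct (inner Hs) as [_ HN]; destruct core_bounds as [[Hc _] _].
pose proof alpha_ge1; pose proof drop_coef_pos as HD; pose proof log_coef_bounds.
assert (Hs2 : 0 < s ^ 2) by nra.
assert (Hk : k0 * dR <= 2 * (8 + D) / c).
{ replace (k0 * dR) with ((1 + th) * (A3 * (s ^ 2 / (s ^ 2 + c) ^ 2) + D * (N / 2 * (s / (s ^ 2 + c)))))
    by (unfold k0, dR; field; lra).
  assert (H1 : s ^ 2 / (s ^ 2 + c) ^ 2 <= / c).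
  { apply Rle_div_l; [nra|].
    apply Rmult_le_reg_l with c; [lra|].
    replace (c * (/ c * (s ^ 2 + c) ^ 2)) with ((s ^ 2 + c) ^ 2) by (field; lra); nra. }
  assert (H2 : s / (s ^ 2 + c) <= / c).
  { apply Rle_div_l; [nra|].
    apply Rmult_le_reg_l with c; [lra|].
    replace (c * (/ c * (s ^ 2 + c))) with (s ^ 2 + c) by (field; lra); nra. }
  assert (0 < s ^ 2 / (s ^ 2 + c) ^ 2) by (apply Rdiv_lt_0_compat; nra).
  assert (0 < s / (s ^ 2 + c)) by (apply Rdiv_lt_0_compat; nra).
  assert (0 < / c) by now apply Rinv_0_lt_compat.
  replace (2 * (8 + D) / c) with (2 * (8 * / c + D * (1 * / c))) by (field; lra).
  apply Rmult_le_compat; [nra| |lra|].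
  - apply Rplus_le_le_0_compat; [apply Rmult_le_pos; lra|].
    apply Rmult_le_pos; [lra|apply Rmult_le_pos; lra].
  - apply Rplus_le_compat; [apply Rmult_le_compat; lra|].
    apply Rmult_le_compat_l; [lra|]; apply Rmult_le_compat; lra. }
assert (Hmu : mu * (8 * C * (8 + D)) <= th ^ 2).
{ apply Rle_div_r; [nra|apply mu_bounds]. }
rewrite Rmult_assoc.
apply Rle_trans with (mu / al * C * (2 * (8 + D) / c)).
- assert (0 < mu / al) by (apply Rdiv_lt_0_compat; lra).
  assert (0 <= k0 * dR).
  { apply Rmult_le_pos.
    - apply Rmult_le_pos; [lra|]; apply Rdiv_le_0_compat; lra.
    - apply Rplus_le_le_0_compat; [apply Rdiv_le_0_compat; lra|].
      apply Rmult_le_pos; [lra|]; apply Rdiv_le_0_compat; lra. }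
  apply Rmult_le_compat; [nra|lra|nra|exact Hk].
- replace (mu / al * C * (2 * (8 + D) / c)) with (mu * (8 * C * (8 + D)) / (4 * th))
    by (unfold c; field; lra).
  apply Rle_div_l; nra.
Qed.

(** Here [c <= th * rho^2] gives [k0 >= 1], so the drift term is covered. The loss is at most a
    multiple of [N], and the derivative of the growing factor is also proportional to [N]; [B] is
    chosen to match the two, [m] being at most 2. *)
Lemma outer_case :
  rho < s -> a + mu / al * fp * (k0 * m) * dR
             <= a * (k0 * m) + 2 / al * (dk0 * m + k0 * (B * (N / (2 * s)))).
Proof.
intros Hs; destruct core_bounds as [[Hc Hc'] _].
pose proof alpha_ge1; pose proof drop_coef_pos as HD; pose proof log_coef_bounds.
assert (Hr2 : 0 < rho ^ 2) by nra.
assert (Hs2 : rho ^ 2 < s ^ 2) by nra.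
assert (Hk1 : 1 <= k0).
{ unfold k0; replace ((1 + th) * (s ^ 2 / (s ^ 2 + c))) with ((1 + th) * s ^ 2 / (s ^ 2 + c))
    by (field; lra).
  apply Rle_div_r; nra. }
assert (Hdk : 0 <= 2 / al * (dk0 * m)).
{ apply Rmult_le_pos; [apply Rdiv_le_0_compat; lra|].
  apply Rmult_le_pos; [apply Rmult_le_pos; [lra|]|lra].
  apply Rdiv_le_0_compat; [lra|apply pow_lt; lra]. }
assert (Hak : a <= a * (k0 * m)) by (assert (1 <= k0 * m) by nra; nra).
assert (HR : dR <= Q * N).
{ unfold dR, Q; rewrite Rmult_plus_distr_r; apply Rplus_le_compat.
  - apply Rle_trans with (A3 / rho ^ 2 * 1).
    + rewrite Rmult_1_r; apply Rmult_le_compat_l; [lra|].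
      apply Rinv_le_contravar; lra.
    + apply Rmult_le_compat_l; [apply Rdiv_le_0_compat; lra|lra].
  - replace (D / (2 * rho) * N) with (D * (N / (2 * rho))) by (field; lra).
    apply Rmult_le_compat_l; [lra|]; apply Rmult_le_compat_l; [lra|].
    apply Rinv_le_contravar; lra. }
assert (HdR : 0 <= dR).
{ apply Rplus_le_le_0_compat; [apply Rdiv_le_0_compat; lra|].
  apply Rmult_le_pos; [lra|]; apply Rdiv_le_0_compat; lra. }
assert (Hmu : 0 < mu / al) by (apply Rdiv_lt_0_compat; lra).
assert (Hloss : mu / al * fp * (k0 * m) * dR <= mu / al * C * (k0 * 2) * (Q * N)).
{ assert (0 <= mu / al * fp) by (apply Rmult_le_pos; lra).
  apply Rmult_le_compat; [apply Rmult_le_pos; nra|exact HdR| |exact HR].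
  apply Rmult_le_compat; [assumption|nra|nra|nra]. }
assert (HQ : 0 < Q).
{ apply Rplus_lt_0_compat; apply Rdiv_lt_0_compat; lra. }
assert (Hgain : mu / al * C * (k0 * 2) * (Q * N) <= 2 / al * (k0 * (B * (N / (2 * s))))).
{ replace (2 / al * (k0 * (B * (N / (2 * s)))))
    with (mu / al * C * (k0 * 2) * (Q * N) * / s) by (unfold B; field; lra).
  assert (1 <= / s) by (rewrite <- Rinv_1; apply Rinv_le_contravar; lra).
  assert (0 <= mu / al * C * (k0 * 2) * (Q * N))
    by (apply Rmult_le_pos; [apply Rmult_le_pos; [apply Rmult_le_pos|]|apply Rmult_le_pos]; lra).
  nra. }
rewrite Rmult_plus_distr_l; lra.
Qed.

Lemma barrier_inequality :
  a + mu / al * fp * (k0 * m) * dR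
  <= a * (k0 * m) + 2 / al * (dk0 * m + k0 * (B * (N / (2 * s)))).
Proof.
destruct (Rle_or_lt s rho) as [Hs|Hs]; [|now apply outer_case].
pose proof (inner_gain Hs) as Hg; pose proof (inner_loss Hs) as Hl.
destruct core_bounds as [[Hc _] _]; pose proof alpha_ge1; pose proof drop_coef_pos; pose proof log_coef_bounds.
assert (0 <= 2 / al * (k0 * (B * (N / (2 * s))))).
{ assert (0 < Q) by (apply Rplus_lt_0_compat; apply Rdiv_lt_0_compat; nra).
  assert (0 <= B) by (unfold B; repeat apply Rmult_le_pos; lra).
  assert (0 <= k0) by (apply Rmult_le_pos; [lra|]; apply Rdiv_le_0_compat; nra).
  assert (0 <= N / (2 * s)) by (apply Rdiv_le_0_compat; lra).
  assert (0 <= 2 / al) by (apply Rdiv_le_0_compat; lra).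
  apply Rmult_le_pos; [lra|]; apply Rmult_le_pos; [lra|]; now apply Rmult_le_pos. }
replace (a * (k0 * m) + 2 / al * (dk0 * m + k0 * (B * (N / (2 * s)))))
  with ((a * k0 + 2 / al * dk0) * m + 2 / al * (k0 * (B * (N / (2 * s))))) by ring.
replace (mu / al * fp * (k0 * m) * dR) with (mu / al * fp * k0 * dR * m) by ring.
(* [inner_gain] minus [inner_loss]; multiplication by [m >= 1] keeps it since [a >= 0]. *)
assert (a <= a * k0 + 2 / al * dk0 - mu / al * fp * k0 * dR) by lra.
nra.
Qed.

End Barrier_inequalities.

(** * The running maximum M and its integral *)

Section Running_maximum.

Variables phi psi M : R -> R.
Hypothesis psi_nonneg : forall r, 0 <= r <= 1 -> 0 <= psi r.
Hypothesis phi_lipschitz : lipschitz_on unit_interval phi.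
Hypothesis psi_lipschitz : lipschitz_on unit_interval psi.
Hypothesis phi_0 : phi 0 = 1.
Hypothesis psi_0 : psi 0 = 1.
Hypothesis phi_pos : forall r, 0 <= r < 1 -> 0 < phi r.
Hypothesis M_def : forall s, 0 <= s < 1 ->
  is_max_on (fun r => 0 <= r <= s) (fun r => psi r / phi r) (M s).
Hypothesis M_integrable : ex_RInt_gen M (at_point 0) (at_left 1).

Lemma psi_le_M r s : 0 <= r <= s -> s < 1 -> psi r <= M s * phi r.
Proof.
intros Hr Hs; destruct (M_def s) as [_ Hmax]; [lra|].
apply Rle_div_l; [apply phi_pos; lra|now apply Hmax].
Qed.

Lemma M_nondecreasing r s : 0 <= r <= s -> s < 1 -> M r <= M s.
Proof.
intros Hr Hs; destruct (M_def r) as [[x [Hx <-]] _]; [lra|].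
destruct (M_def s) as [_ Hmax]; [lra|]; apply Hmax; lra.
Qed.

Lemma M_ge1 s : 0 <= s < 1 -> 1 <= M s.
Proof.
intros Hs; pose proof (psi_le_M 0 s ltac:(lra) ltac:(lra)) as H.
rewrite phi_0, psi_0 in H; lra.
Qed.

Lemma M_at_0 : M 0 = 1.
Proof.
destruct (M_def 0) as [[r [Hr <-]] _]; [lra|].
replace r with 0 by lra; rewrite phi_0, psi_0; field.
Qed.

Lemma ratio_continuous s : 0 <= s < 1 -> forall eps, 0 < eps -> exists d, 0 < d /\
  forall r, 0 <= r < 1 -> Rabs (r - s) < d -> Rabs (psi r / phi r - psi s / phi s) < eps.
Proof.
intros Hs eps Heps.
assert (Hc : continuous (fun r => psi (clamp r) * / phi (clamp r)) s).
{ apply continuous_mult_R.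
  - apply (continuous_on_unit_interval psi clamp); trivial; [apply clamp_bounds|apply continuous_clamp].
  - apply (continuous_inv_R (fun r => phi (clamp r))).
    + apply (continuous_on_unit_interval phi clamp); trivial; [apply clamp_bounds|apply continuous_clamp].
    + rewrite clamp_id by lra; apply Rgt_not_eq, phi_pos; lra. }
apply continuity_pt_filterlim in Hc.
destruct (Hc eps Heps) as [d [Hd Hlim]]; exists d; split; [exact Hd|].
intros r Hr Hrs; destruct (Req_dec s r) as [<-|Hne]; [now rewrite Rminus_diag, Rabs_R0|].
specialize (Hlim r); simpl in Hlim; unfold Rdist in Hlim.
rewrite !clamp_id in Hlim by lra; apply Hlim; split; [split; [exact I|exact Hne]|exact Hrs].
Qed.

(** [M] is specified on [0, 1) only. Freezing it to the left of 0 makes its integral differentiable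
    at 0 from both sides. *)
Definition Mpos (r : R) : R := M (Rmax 0 r).

Lemma Mpos_nonneg r : 0 <= r -> Mpos r = M r.
Proof. intros Hr; unfold Mpos; now rewrite Rmax_right. Qed.

(** When the interval grows, the maximum either stays in the old part or moves to a new point, where
    the ratio is close to its value at the old end point. So the change of [M] is controlled by the
    oscillation of the ratio between the two ends. *)
Lemma continuous_Mpos r : r < 1 -> continuous Mpos r.
Proof.
intros Hr; apply continuity_pt_filterlim; intros eps Heps.
unfold Mpos; set (s := Rmax 0 r).
assert (Hs : 0 <= s < 1) by (unfold s, Rmax; destruct Rle_dec; lra).
destruct (ratio_continuous s Hs (eps / 2)) as [d [Hd Hlim]]; [lra|].
exists (Rmin d (1 - s)); split; [apply Rmin_pos; lra|].
intros y [_ Hy]; simpl in *; unfold Rdist in *.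
set (s' := Rmax 0 y).
assert (Hss : Rabs (s' - s) <= Rabs (y - r)).
{ unfold s', s, Rmax, Rabs; repeat destruct Rle_dec; repeat destruct Rcase_abs; lra. }
assert (Hd' : Rabs (s' - s) < d /\ Rabs (s' - s) < 1 - s).
{ revert Hy; unfold Rmin; destruct Rle_dec; lra. }
destruct Hd' as [H1 H2]; apply Rabs_def2 in H1; apply Rabs_def2 in H2.
assert (Hs' : 0 <= s' < 1) by (split; [apply Rmax_l|lra]).
assert (Hq : forall r0, Rmin s s' <= r0 <= Rmax s s' ->
  Rabs (psi r0 / phi r0 - psi s / phi s) < eps / 2).
{ intros r0; unfold Rmin, Rmax; destruct Rle_dec; intros; apply Hlim; try lra;
    apply Rabs_def1; lra. }
destruct (M_def s Hs) as [[u [Hu HMu]] Hmax]; destruct (M_def s' Hs') as [[v [Hv HMv]] Hmax'].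
destruct (Rle_or_lt s s') as [Hle|Hlt].
- rewrite Rmin_left, Rmax_right in Hq by lra.
  pose proof (M_nondecreasing s s' ltac:(lra) ltac:(lra)).
  destruct (Rle_or_lt v s) as [Hvs|Hvs].
  + specialize (Hmax v ltac:(lra)); apply Rabs_def1; lra.
  + specialize (Hq v ltac:(lra)); specialize (Hmax s ltac:(lra)).
    apply Rabs_def2 in Hq; apply Rabs_def1; lra.
- rewrite Rmin_right, Rmax_left in Hq by lra.
  pose proof (M_nondecreasing s' s ltac:(lra) ltac:(lra)).
  destruct (Rle_or_lt u s') as [Hus|Hus].
  + specialize (Hmax' u ltac:(lra)); apply Rabs_def1; lra.
  + pose proof (Hq u ltac:(lra)) as Hqu; specialize (Hq s' ltac:(lra)).
    specialize (Hmax' s' ltac:(lra)).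
    apply Rabs_def2 in Hq; apply Rabs_def2 in Hqu; apply Rabs_def1; lra.
Qed.

Definition Mint (r : R) : R := RInt Mpos 0 r.

Lemma ex_RInt_Mpos r : r < 1 -> ex_RInt Mpos 0 r.
Proof.
intros Hr; apply (ex_RInt_continuous Mpos); intros z Hz; apply continuous_Mpos.
revert Hz; unfold Rmax; destruct Rle_dec; lra.
Qed.

Lemma is_derive_Mint r : r < 1 -> is_derive Mint r (Mpos r).
Proof.
intros Hr; apply (is_derive_RInt Mpos _ 0); [|now apply continuous_Mpos].
assert (He : 0 < 1 - r) by lra.
exists (mkposreal _ He); intros y Hy; apply Rabs_def2 in Hy; simpl in Hy.
unfold minus, plus, opp in Hy; simpl in Hy.
apply (RInt_correct Mpos), ex_RInt_Mpos; lra.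
Qed.

Lemma Mint_0 : Mint 0 = 0.
Proof. unfold Mint; now rewrite RInt_point. Qed.

Lemma Mint_nondecreasing r s : 0 <= r <= s -> s < 1 -> Mint r <= Mint s.
Proof.
intros Hr Hs; apply (nondecreasing_of_derive Mint Mpos); [lra|..].
- intros x Hx; apply is_derive_Mint; lra.
- intros x Hx; apply (ex_derive_continuous Mint); eexists; apply is_derive_Mint; lra.
- intros x Hx; rewrite Mpos_nonneg by lra; pose proof (M_ge1 x ltac:(lra)); lra.
Qed.

Lemma Mint_bounded : exists J, forall r, 0 <= r < 1 -> 0 <= Mint r <= J.
Proof.
destruct M_integrable as [I0 HI].
destruct (HI (fun y => Rabs (y - I0) < 1)) as [Q P HQ [d HP] H].
{ exists (mkposreal 1 Rlt_0_1); intros y Hy; exact Hy. }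
exists (I0 + 1); intros r Hr; split.
{ rewrite <- Mint_0; apply Mint_nondecreasing; lra. }
pose proof (cond_pos d).
(* Moves [r] up to a point so close to 1 that the integral is within 1 of its limit; the integral up
   to [r] is no larger. *)
set (u := Rmax r (1 - d / 2)).
assert (Hu : r <= u < 1 /\ 1 - d < u) by (unfold u, Rmax; destruct Rle_dec; lra).
destruct (H 0 u HQ) as [y [Hy Hlim]].
{ apply HP; [|lra]; apply Rabs_def1; unfold minus, plus, opp; simpl; lra. }
simpl in Hy; apply Rabs_def2 in Hlim.
assert (HMu : Mint u = y).
{ apply is_RInt_unique, (is_RInt_ext M); [|exact Hy].
  intros x; rewrite Rmin_left, Rmax_right by lra; intros Hx; now rewrite Mpos_nonneg by lra. }
pose proof (Mint_nondecreasing r u ltac:(lra) ltac:(lra)); lra.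
Qed.

End Running_maximum.
(** * The integral of the reciprocal of f *)

Lemma continuous_comp_Rmax (f : R -> R) :
  (forall x, 0 <= x -> continue_in f nonneg_reals x) ->
  forall s, continuous (fun s => f (Rmax 0 s)) s.
Proof.
intros Hf s; apply continuity_pt_filterlim; intros eps Heps.
destruct (Hf (Rmax 0 s) (Rmax_l 0 s) eps Heps) as [d [Hd Hlim]].
exists d; split; [exact Hd|].
intros x [_ Hx]; simpl in *; unfold Rdist in *.
destruct (Req_dec (Rmax 0 s) (Rmax 0 x)) as [->|Hne].
- now rewrite Rminus_diag, Rabs_R0.
- apply Hlim; split; [split; [apply Rmax_l|exact Hne]|].
  revert Hx; unfold Rmax, Rabs; repeat destruct Rle_dec; repeat destruct Rcase_abs; lra.
Qed.

Lemma is_derive_of_D_in (f df : R -> R) (s : R) :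
  0 < s -> D_in f df nonneg_reals s -> is_derive f s (df s).
Proof.
intros Hs HD; apply is_derive_Reals; intros eps Heps.
destruct (HD eps Heps) as [d [Hd Hlim]].
assert (Hm : 0 < Rmin d s) by (apply Rmin_pos; lra).
exists (mkposreal _ Hm); intros h Hh Hhd; simpl in Hhd.
assert (Rabs h < d /\ Rabs h < s) as [H1 H2]
  by (unfold Rmin in Hhd; destruct Rle_dec; lra).
apply Rabs_def2 in H2.
specialize (Hlim (s + h)); simpl in Hlim; unfold Rdist in Hlim.
replace (s + h - s) with h in Hlim by ring.
apply Hlim; split; [split; [unfold nonneg_reals; lra|lra]|exact H1].
Qed.

Section Problem.

Variables (f df : R -> R) (K : R).
Hypothesis f_pos : forall s, 0 <= s -> 0 < f s.
Hypothesis f_df : forall s, 0 <= s -> D_in f df nonneg_reals s.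
Hypothesis f_convex : convex_on nonneg_reals f.
Hypothesis f_nondecreasing : nondecreasing_on nonneg_reals f.
Hypothesis K_def :
  is_RInt_gen (fun s => / f s) (at_point 0) (Rbar_locally p_infty) K.

(* [f] is only constrained on [0, +oo); [fext] is continuous on the whole line. *)
Definition fext (s : R) : R := f (Rmax 0 s).

Lemma fext_nonneg s : 0 <= s -> fext s = f s.
Proof. intros Hs; unfold fext; now rewrite Rmax_right. Qed.

Lemma fext_pos s : 0 < fext s.
Proof. apply f_pos, Rmax_l. Qed.

Lemma fext_nondecreasing x y : x <= y -> fext x <= fext y.
Proof.
intros Hxy; apply f_nondecreasing; try apply Rmax_l.
apply Rmax_lub; [apply Rmax_l|]; eapply Rle_trans; [exact Hxy|apply Rmax_r].
Qed.

Lemma continuous_fext s : continuous fext s.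
Proof.
apply continuous_comp_Rmax; intros x Hx; exact (cont_deriv _ _ _ _ (f_df x Hx)).
Qed.

Lemma is_derive_f s : 0 < s -> is_derive f s (df s).
Proof. intros Hs; apply is_derive_of_D_in; [exact Hs|apply f_df; lra]. Qed.

Lemma df_nonneg s : 0 < s -> 0 <= df s.
Proof.
intros Hs; destruct (Rle_or_lt 0 (df s)) as [|Hneg]; [assumption|exfalso].
pose proof (is_derive_f s Hs) as Hd; apply is_derive_Reals in Hd.
destruct (Hd (- df s)) as [d Hlim]; [lra|].
pose proof (cond_pos d).
specialize (Hlim (d / 2)); rewrite Rabs_pos_eq in Hlim by lra.
specialize (Hlim ltac:(lra) ltac:(lra)); apply Rabs_def2 in Hlim.
assert (f s <= f (s + d / 2)) by (apply f_nondecreasing; unfold nonneg_reals; lra).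
assert (0 <= (f (s + d / 2) - f s) / (d / 2)) by (apply Rdiv_le_0_compat; lra).
lra.
Qed.

(** By convexity the difference quotients with step at most 1 are below [f (s + 1) - f s]. This
    bounds [f'] along the supersolution by a value of [f]. *)
Lemma df_le s : 0 < s -> df s <= f (s + 1).
Proof.
intros Hs; destruct (Rle_or_lt (df s) (f (s + 1))) as [|Hlt]; [assumption|exfalso].
pose proof (is_derive_f s Hs) as Hd; apply is_derive_Reals in Hd.
destruct (Hd (df s - f (s + 1))) as [d Hlim]; [lra|].
pose proof (cond_pos d).
set (h := Rmin (d / 2) 1).
assert (Hh : 0 < h <= 1 /\ h < d) by (unfold h, Rmin; destruct Rle_dec; lra).
specialize (Hlim h); rewrite Rabs_pos_eq in Hlim by lra.
specialize (Hlim ltac:(lra) ltac:(lra)); apply Rabs_def2 in Hlim.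
assert (Hc := f_convex (s + 1) s h ltac:(unfold nonneg_reals; lra)
   ltac:(unfold nonneg_reals; lra) ltac:(lra)).
replace (h * (s + 1) + (1 - h) * s) with (s + h) in Hc by ring.
assert (0 < f s) by (apply f_pos; lra).
assert ((f (s + h) - f s) / h <= f (s + 1)).
{ apply Rle_div_l; [lra|]; nra. }
lra.
Qed.

Lemma is_derive_fext s : 0 < s -> is_derive fext s (df s).
Proof.
intros Hs; apply (is_derive_ext_loc f); [|now apply is_derive_f].
exists (mkposreal s Hs); intros y Hy; apply Rabs_def2 in Hy; simpl in Hy.
unfold minus, plus, opp in Hy; simpl in Hy; symmetry; apply fext_nonneg; lra.
Qed.

Definition recip_int (s : R) : R := RInt (fun x => / fext x) 0 s.

Lemma continuous_recip_fext s : continuous (fun x => / fext x) s.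
Proof.
apply continuity_pt_filterlim, (continuity_pt_inv fext).
- apply continuity_pt_filterlim, continuous_fext.
- pose proof (fext_pos s); lra.
Qed.

Lemma is_derive_recip_int s : is_derive recip_int s (/ fext s).
Proof.
apply (is_derive_RInt (fun x => / fext x) _ 0); [|apply continuous_recip_fext].
apply filter_forall; intros y; apply (RInt_correct (fun x => / fext x)), ex_RInt_continuous.
intros z _; apply continuous_recip_fext.
Qed.

Lemma continuous_recip_int s : continuous recip_int s.
Proof.
apply (ex_derive_continuous recip_int); exists (/ fext s); apply is_derive_recip_int.
Qed.

Lemma recip_int_0 : recip_int 0 = 0.
Proof. unfold recip_int; now rewrite RInt_point. Qed.

Lemma recip_int_increasing x y : x < y -> recip_int x < recip_int y.
Proof.
intros Hxy; destruct (MVT_gen recip_int x y (fun s => / fext s)) as [c [_ Hc]].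
- intros s _; apply is_derive_recip_int.
- intros s _; apply continuity_pt_filterlim, continuous_recip_int.
- pose proof (Rinv_0_lt_compat _ (fext_pos c)); nra.
Qed.

Lemma recip_int_limit (eps : posreal) :
  exists s0, forall s, s0 <= s -> Rabs (recip_int s - K) < eps.
Proof.
destruct (K_def (fun y => Rabs (y - K) < eps)) as [Q P HQ [s0 HP] H].
{ exists eps; intros y Hy; exact Hy. }
exists (Rmax 0 s0 + 1); intros s Hs.
pose proof (Rmax_l 0 s0); pose proof (Rmax_r 0 s0).
destruct (H 0 s HQ (HP s ltac:(lra))) as [y [Hy Hlim]]; simpl in Hy.
replace (recip_int s) with y; [exact Hlim|].
symmetry; apply is_RInt_unique.
apply (is_RInt_ext (fun x => / f x)); [|exact Hy].
intros x; rewrite Rmin_left, Rmax_right by lra; intros Hx; rewrite fext_nonneg by lra; reflexivity.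
Qed.

Lemma recip_int_lt s : recip_int s < K.
Proof.
destruct (Rlt_or_le (recip_int s) K) as [|Hle]; [assumption|exfalso].
pose proof (recip_int_increasing s (s + 1) ltac:(lra)) as Hlt.
assert (Heps : 0 < recip_int (s + 1) - K) by lra.
destruct (recip_int_limit (mkposreal _ Heps)) as [s0 Hs0].
specialize (Hs0 (Rmax s0 (s + 1)) (Rmax_l _ _)); simpl in Hs0; apply Rabs_def2 in Hs0.
destruct (Rle_lt_or_eq_dec _ _ (Rmax_r s0 (s + 1))) as [Hlt'|Heq].
- apply recip_int_increasing in Hlt'; lra.
- rewrite <- Heq in Hs0; lra.
Qed.

Lemma K_pos : 0 < K.
Proof. rewrite <- recip_int_0; apply recip_int_lt. Qed.

(** To the left of 0, [fext] is constant. Hence [recip_int] is unbounded below and every [v < K] has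
    a preimage, which keeps the inverse free of case distinctions at 0. *)
Lemma recip_int_neg s : s <= 0 -> recip_int s <= s / f 0.
Proof.
intros Hs; destruct (MVT_gen recip_int s 0 (fun s => / fext s)) as [c [Hc HM]].
- intros x _; apply is_derive_recip_int.
- intros x _; apply continuity_pt_filterlim, continuous_recip_int.
- rewrite Rmin_left, Rmax_right in Hc by lra.
  rewrite recip_int_0 in HM.
  replace (fext c) with (f 0) in HM by (unfold fext; now rewrite Rmax_left by lra).
  unfold Rdiv; lra.
Qed.

Lemma recip_int_surj v : v < K -> exists s, recip_int s = v.
Proof.
intros Hv.
assert (Heps : 0 < K - v) by lra.
destruct (recip_int_limit (mkposreal _ Heps)) as [b Hb].
specialize (Hb b (Rle_refl b)); simpl in Hb; apply Rabs_def2 in Hb.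
pose proof (f_pos 0 (Rle_refl 0)).
set (a := Rmin 0 v * f 0).
assert (Ha : recip_int a <= v).
{ assert (Rmin 0 v <= 0) by apply Rmin_l; assert (Rmin 0 v <= v) by apply Rmin_r.
  assert (a <= 0) by (unfold a; nra).
  eapply Rle_trans; [now apply recip_int_neg|].
  unfold a; replace (Rmin 0 v * f 0 / f 0) with (Rmin 0 v) by (field; lra); lra. }
destruct (IVT_gen recip_int a b v) as [s [_ Hs]].
- intros x; apply continuity_pt_filterlim, continuous_recip_int.
- rewrite Rmin_left, Rmax_right by lra; lra.
- now exists s.
Qed.

Definition recip_int_inv (v : R) : R :=
  epsilon (inhabits 0) (fun s => recip_int s = v).

Lemma recip_int_invK v : v < K -> recip_int (recip_int_inv v) = v.
Proof. intros Hv; unfold recip_int_inv; apply epsilon_spec; now apply recip_int_surj. Qed.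

Lemma recip_int_inv_le u v : u <= v -> v < K -> recip_int_inv u <= recip_int_inv v.
Proof.
intros Huv Hv; destruct (Rle_or_lt (recip_int_inv u) (recip_int_inv v)) as [|Hlt]; [assumption|].
apply recip_int_increasing in Hlt; rewrite !recip_int_invK in Hlt; lra.
Qed.

Lemma recip_int_inv_pos v : 0 < v -> v < K -> 0 < recip_int_inv v.
Proof.
intros H0 Hv; destruct (Rlt_or_le 0 (recip_int_inv v)) as [|Hle]; [assumption|].
destruct Hle as [Hlt|Heq].
- apply recip_int_increasing in Hlt; rewrite recip_int_invK, recip_int_0 in Hlt; lra.
- pose proof (recip_int_invK v Hv) as H; rewrite Heq, recip_int_0 in H; lra.
Qed.

Lemma is_derive_recip_int_inv v :
  v < K -> is_derive recip_int_inv v (fext (recip_int_inv v)).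
Proof.
intros Hv; apply is_derive_Reals; intros eps Heps.
set (s := recip_int_inv v).
pose proof (continuous_fext s) as Hc; apply continuity_pt_filterlim in Hc.
destruct (Hc eps Heps) as [d [Hd Hlim]]; simpl in Hlim; unfold Rdist in Hlim.
assert (Hs : recip_int s = v) by now apply recip_int_invK.
pose proof (recip_int_increasing (s - d / 2) s ltac:(lra)) as Hl.
pose proof (recip_int_increasing s (s + d / 2) ltac:(lra)) as Hr.
(* For steps below [e] the value [v + h] stays in the image of the interval of radius [d / 2] around
   [s], so the inverse stays in that interval; the mean value theorem then gives the quotient as a
   value of [fext] there. *)
set (e := Rmin (K - v) (Rmin (v - recip_int (s - d / 2)) (recip_int (s + d / 2) - v))).
assert (He : 0 < e) by (unfold e; repeat apply Rmin_pos; lra).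
exists (mkposreal e He); intros h Hh Hhe; simpl in Hhe.
apply Rabs_def2 in Hhe.
assert (Hb : v + h < K /\ recip_int (s - d / 2) < v + h < recip_int (s + d / 2)).
{ unfold e in Hhe; revert Hhe; unfold Rmin; repeat destruct Rle_dec; lra. }
destruct Hb as [HbK Hb].
set (s' := recip_int_inv (v + h)).
assert (Hs' : recip_int s' = v + h) by now apply recip_int_invK.
assert (Hnear : s - d / 2 <= s' <= s + d / 2).
{ split; apply Rnot_lt_le; intros Hlt; apply recip_int_increasing in Hlt; lra. }
destruct (MVT_gen recip_int s s' (fun s => / fext s)) as [c [Hc' HM]].
- intros x _; apply is_derive_recip_int.
- intros x _; apply continuity_pt_filterlim, continuous_recip_int.
- rewrite Hs, Hs' in HM.
  pose proof (fext_pos c).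
  assert (Hq : s' - s = fext c * h).
  { replace h with (v + h - v) by ring; rewrite HM; field; lra. }
  rewrite Hq; replace (fext c * h / h) with (fext c) by now field.
  destruct (Req_dec s c) as [<-|Hne]; [now rewrite Rminus_diag, Rabs_R0|].
  apply Hlim; split; [now split|].
  revert Hc'; unfold Rmin, Rmax; repeat destruct Rle_dec; intros; apply Rabs_def1; lra.
Qed.

(** * The upper bound *)

(* The term coming from the second derivative of [recip_int] has a sign because [f] is non-decreasing. *)
Lemma barrier_slice (U : R -> R) (x0 s B : R) :
  0 < s ->
  locally x0 (fun x => ex_derive U x /\ 0 < U x) ->
  ex_derive (Derive U) x0 ->
  locally x0 (fun x => recip_int (U x0) + B * ln (x0 ^ 2 + s)
                       <= recip_int (U x) + B * ln (x ^ 2 + s)) ->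
  Derive U x0 = - f (U x0) * (2 * B * x0 / (x0 ^ 2 + s)) /\
  0 <= Derive_n U 2 x0 / f (U x0)
       + B * (2 / (x0 ^ 2 + s) - 4 * x0 ^ 2 / (x0 ^ 2 + s) ^ 2).
Proof.
intros Hs Hloc HU2 Hmin.
assert (Hpos : forall x, 0 < x ^ 2 + s) by (intros x; pose proof (pow2_ge_0 x); lra).
assert (HUx0 := locally_singleton _ _ Hloc); destruct HUx0 as [HU1 HU0].
assert (Hf0 : 0 < f (U x0)) by (apply f_pos; lra).
destruct (second_derivative_test
  (fun x => recip_int (U x) + B * ln (x ^ 2 + s))
  (fun x => Derive U x * / fext (U x) + B * (2 * x / (x ^ 2 + s)))
  x0
  (Derive_n U 2 x0 / f (U x0) - df (U x0) * (Derive U x0) ^ 2 / (f (U x0)) ^ 2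
   + B * (2 / (x0 ^ 2 + s) - 4 * x0 ^ 2 / (x0 ^ 2 + s) ^ 2))) as [H1 H2].
- revert Hloc; apply filter_imp; intros x [Hx _].
  apply (is_derive_plus (fun x => recip_int (U x)) (fun x => B * ln (x ^ 2 + s))).
  + apply (is_derive_comp recip_int U); [apply is_derive_recip_int|now apply Derive_correct].
  + auto_derive; [apply Hpos|]; field; apply Rgt_not_eq, Hpos.
- assert (Hder : is_derive (fun x => / fext (U x)) x0 (- df (U x0) * Derive U x0 / (f (U x0)) ^ 2)).
  { assert (HfU : is_derive (fun x => fext (U x)) x0 (Derive U x0 * df (U x0))).
    { apply (is_derive_comp fext U); [now apply is_derive_fext|now apply Derive_correct]. }
    apply (is_derive_inv (fun x => fext (U x))) in HfU;
      [|apply Rgt_not_eq, fext_pos].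
    replace (- df (U x0) * Derive U x0 / f (U x0) ^ 2)
      with (- (Derive U x0 * df (U x0)) / fext (U x0) ^ 2); [exact HfU|].
    rewrite fext_nonneg by lra; field; lra. }
  apply (is_derive_plus (fun x => Derive U x * / fext (U x))
           (fun x => B * (2 * x / (x ^ 2 + s)))).
  + replace (Derive_n U 2 x0 / f (U x0) - df (U x0) * Derive U x0 ^ 2 / f (U x0) ^ 2)
      with (Derive_n U 2 x0 * / fext (U x0)
            + Derive U x0 * (- df (U x0) * Derive U x0 / (f (U x0)) ^ 2)).
    * apply (is_derive_mult (Derive U) (fun x => / fext (U x))); [|exact Hder|].
      -- now apply (Derive_correct (Derive U)).
      -- intros; apply Rmult_comm.
    * rewrite fext_nonneg by lra; field; lra.
  + pose proof (Hpos x0).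
    auto_derive; [apply Rgt_not_eq, Hpos|]; field; apply Rgt_not_eq, Hpos.
- exact Hmin.
- rewrite fext_nonneg in H1 by lra.
  split.
  + apply (Rmult_eq_reg_r (/ f (U x0))); [|apply Rinv_neq_0_compat; lra].
    replace (- f (U x0) * (2 * B * x0 / (x0 ^ 2 + s)) * / f (U x0))
      with (- (B * (2 * x0 / (x0 ^ 2 + s)))); [lra|].
    pose proof (Hpos x0); field; split; lra.
  + assert (0 <= df (U x0) * Derive U x0 ^ 2 / f (U x0) ^ 2).
    { apply Rdiv_le_0_compat; [|apply pow_lt; lra].
      apply Rmult_le_pos; [apply df_nonneg; lra|apply pow2_ge_0]. }
    lra.
Qed.

Lemma lambda_bound (phi psi : R -> R) (u : R -> R -> R) (lam al d A : R) :
  classical_solution f phi psi lam al u ->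
  0 < lam -> 0 < al -> 0 < d <= 1 / 2 -> 0 < A ->
  (forall r, 0 <= r <= d -> 0 <= phi r <= 1 /\ A < psi r) ->
  lam * A / (2 * al) * ln (1 + al * d ^ 2 / 2) <= K.
Proof.
intros [Hdiff [_ [Heq [Hupos _]]]] Hlam Hal Hd HA Hpp.
apply Rnot_lt_le; intros HK.
set (B := lam * A / (2 * al)) in *; set (c := 2 / al).
assert (Hc : 0 < c) by (apply Rdiv_lt_0_compat; lra).
assert (HB : 0 < B) by (apply Rdiv_lt_0_compat; nra).
(* The minimum is taken over a square, which is compact as a box and lies in the unit disk because
   [d <= 1 / 2]. *)
assert (Hsq : forall x y, -d <= x <= d -> -d <= y <= d -> disk x y).
{ intros x y Hx Hy; apply rad_lt; [lra|]; nra. }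
set (h := fun x y => recip_int (u x y) + B * ln (x ^ 2 + y ^ 2 + c)).
assert (Hpos : forall x y, 0 < x ^ 2 + y ^ 2 + c).
{ intros x y; pose proof (pow2_ge_0 x); pose proof (pow2_ge_0 y); lra. }
destruct (attains_min_on_square h d) as [x0 [y0 [[Hx0 Hy0] Hmin]]]; [lra| |].
{ intros x y Hx Hy; apply continuity_2d_pt_plus.
  - apply continuity_1d_2d_pt_comp; [apply continuity_pt_filterlim, continuous_recip_int|].
    apply (Hdiff x y (Hsq x y Hx Hy)).
  - apply continuity_2d_pt_mult; [apply continuity_2d_pt_const|].
    apply (continuity_1d_2d_pt_comp ln (fun x y => x ^ 2 + y ^ 2 + c)).
    + apply continuity_pt_filterlim, (ex_derive_continuous ln); auto_derive; apply Hpos.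
    + apply continuity_2d_pt_plus; [|apply continuity_2d_pt_const].
      apply continuity_2d_pt_plus; simpl.
      * repeat apply continuity_2d_pt_mult;
          try apply continuity_2d_pt_id1; apply continuity_2d_pt_const.
      * repeat apply continuity_2d_pt_mult;
          try apply continuity_2d_pt_id2; apply continuity_2d_pt_const. }
(* The negated claim makes [h 0 0] smaller than [B * ln (d^2 + c)]. At distance at least [d] from
   the origin [h] exceeds that value, as [recip_int] of a positive number is positive; so the
   minimum lies strictly inside. *)
assert (Hneg : h x0 y0 < B * ln (d ^ 2 + c)).
{ eapply Rle_lt_trans; [apply (Hmin 0 0); lra|].
  unfold h; pose proof (recip_int_lt (u 0 0)).
  replace (0 ^ 2 + 0 ^ 2 + c) with c by ring.
  replace (d ^ 2 + c) with (c * (1 + al * d ^ 2 / 2)) by (unfold c; field; lra).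
  rewrite ln_mult; [nra|lra|].
  assert (0 <= al * d ^ 2 / 2) by (apply Rdiv_le_0_compat; nra); lra. }
assert (Hu0 : 0 < u x0 y0) by now apply Hupos, Hsq.
assert (Hin : x0 ^ 2 + y0 ^ 2 < d ^ 2).
{ apply Rnot_le_lt; intros Hle.
  assert (ln (d ^ 2 + c) <= ln (x0 ^ 2 + y0 ^ 2 + c)).
  { apply ln_le; [|lra]; pose proof (pow2_ge_0 d); lra. }
  pose proof (recip_int_increasing 0 _ Hu0) as HF; rewrite recip_int_0 in HF.
  unfold h in Hneg; nra. }
assert (Hx0' : -d < x0 < d) by nra; assert (Hy0' : -d < y0 < d) by nra.
assert (Hnear : forall z, -d < z < d -> locally z (fun z' => -d <= z' <= d)).
{ intros z Hz; assert (He : 0 < Rmin (d - z) (z + d)) by (apply Rmin_pos; lra).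
  exists (mkposreal _ He); intros z' Hz'; apply Rabs_def2 in Hz'; simpl in Hz'.
  unfold minus, plus, opp in Hz'; simpl in Hz'.
  revert Hz'; unfold Rmin; destruct Rle_dec; lra. }
destruct (Hdiff x0 y0 (Hsq _ _ Hx0 Hy0)) as [_ [_ [_ [[_ [Hxx _]] [_ [_ [Hyy _]]]]]]].
destruct (barrier_slice (fun x => u x y0) x0 (y0 ^ 2 + c) B) as [Hgx Hlx].
{ pose proof (pow2_ge_0 y0); lra. }
{ generalize (Hnear x0 Hx0'); apply filter_imp; intros x Hx; split; [|now apply Hupos, Hsq].
  apply (Hdiff x y0 (Hsq _ _ Hx Hy0)). }
{ exact Hxx. }
{ generalize (Hnear x0 Hx0'); apply filter_imp; intros x Hx.
  rewrite <- !Rplus_assoc; now apply Hmin. }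
destruct (barrier_slice (fun y => u x0 y) y0 (x0 ^ 2 + c) B) as [Hgy Hly].
{ pose proof (pow2_ge_0 x0); lra. }
{ generalize (Hnear y0 Hy0'); apply filter_imp; intros y Hy; split; [|now apply Hupos, Hsq].
  apply (Hdiff x0 y (Hsq _ _ Hx0 Hy)). }
{ exact Hyy. }
{ generalize (Hnear y0 Hy0'); apply filter_imp; intros y Hy.
  replace (y0 ^ 2 + (x0 ^ 2 + c)) with (x0 ^ 2 + y0 ^ 2 + c) by ring.
  replace (y ^ 2 + (x0 ^ 2 + c)) with (x0 ^ 2 + y ^ 2 + c) by ring.
  now apply Hmin. }
specialize (Heq x0 y0 (Hsq _ _ Hx0 Hy0)).
rewrite (Rmult_assoc al), (Rmult_comm (rad x0 y0)), <- Rmult_assoc, Rmult_assoc in Heq.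
rewrite rad_radial_derivative in Heq.
unfold laplacian in Heq.
change (partial_derive 1 0 u x0 y0) with (Derive (fun x => u x y0) x0) in Heq.
change (partial_derive 0 1 u x0 y0) with (Derive (fun y => u x0 y) y0) in Heq.
change (partial_derive 2 0 u x0 y0) with (Derive_n (fun x => u x y0) 2 x0) in Heq.
change (partial_derive 0 2 u x0 y0) with (Derive_n (fun y => u x0 y) 2 y0) in Heq.
rewrite Hgx, Hgy in Heq.
assert (Hr : 0 <= rad x0 y0 <= d).
{ split; [apply rad_nonneg|]; apply Rlt_le, rad_lt; lra. }
destruct (Hpp _ Hr) as [Hphi Hpsi].
set (p := phi (rad x0 y0)) in *; set (q := psi (rad x0 y0)) in *.
assert (Hf0 : 0 < f (u x0 y0)) by (apply f_pos; lra).
set (F := f (u x0 y0)) in *.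
set (uxx := Derive_n (fun x => u x y0) 2 x0) in *.
set (uyy := Derive_n (fun y => u x0 y) 2 y0) in *.
replace (x0 ^ 2 + (y0 ^ 2 + c)) with (x0 ^ 2 + y0 ^ 2 + c) in * by ring.
replace (y0 ^ 2 + (x0 ^ 2 + c)) with (x0 ^ 2 + y0 ^ 2 + c) in * by ring.
set (t := x0 ^ 2 + y0 ^ 2) in *.
assert (Ht : 0 <= t) by (unfold t; pose proof (pow2_ge_0 x0); pose proof (pow2_ge_0 y0); lra).
assert (Hlap : (uxx + uyy) / F = 2 * al * p * B * t / (t + c) - lam * q).
{ replace (uxx + uyy) with (F * (2 * al * p * B * t / (t + c) - lam * q)).
  - field; lra.
  - transitivity (- (lam * q * F) - al * p
      * (x0 * (- F * (2 * B * x0 / (t + c))) + y0 * (- F * (2 * B * y0 / (t + c)))));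
      [|lra].
    unfold t; field; fold t; lra. }
assert (Hsum : 0 <= (uxx + uyy) / F + B * (4 * c / (t + c) ^ 2)).
{ replace (B * (4 * c / (t + c) ^ 2)) with
    (B * (2 / (t + c) - 4 * x0 ^ 2 / (t + c) ^ 2) + B * (2 / (t + c) - 4 * y0 ^ 2 / (t + c) ^ 2)).
  - unfold Rdiv at 1; rewrite Rmult_plus_distr_r; lra.
  - unfold t; field; fold t; lra. }
rewrite Hlap in Hsum.
(* The choice [c = 2 / al] gives the drift and diffusion terms of the barrier the same coefficient
   [lam * A]; with [p <= 1] the sum is controlled by [t^2 + t c + c^2 <= (t + c)^2]. *)
assert (Hfrac : p * t / (t + c) + c ^ 2 / (t + c) ^ 2 <= 1).
{ replace (p * t / (t + c) + c ^ 2 / (t + c) ^ 2)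
    with ((p * t * (t + c) + c ^ 2) / (t + c) ^ 2) by (field; lra).
  apply Rle_div_l; [apply pow_lt; lra|].
  assert (0 <= (1 - p) * (t * (t + c))) by (apply Rmult_le_pos; nra); nra. }
assert (Hend : 2 * al * p * B * t / (t + c) - lam * q + B * (4 * c / (t + c) ^ 2)
  = lam * (A * (p * t / (t + c) + c ^ 2 / (t + c) ^ 2) - q)).
{ replace al with (2 / c) by (unfold c; field; lra).
  replace B with (lam * A * c / 4) by (unfold B, c; field; lra).
  field; lra. }
rewrite Hend in Hsum.
set (X := p * t / (t + c) + c ^ 2 / (t + c) ^ 2) in *.
assert (A * X <= A) by nra.
assert (0 < lam * (q - A * X)) by (apply Rmult_lt_0_compat; lra).
lra.
Qed.
Variables phi psi M : R -> R.
Hypothesis phi_nonneg : forall r, 0 <= r <= 1 -> 0 <= phi r.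
Hypothesis psi_nonneg : forall r, 0 <= r <= 1 -> 0 <= psi r.
Hypothesis phi_nonincreasing : nonincreasing_on unit_interval phi.
Hypothesis phi_lipschitz : lipschitz_on unit_interval phi.
Hypothesis psi_lipschitz : lipschitz_on unit_interval psi.
Hypothesis phi_0 : phi 0 = 1.
Hypothesis psi_0 : psi 0 = 1.
Hypothesis phi_pos : forall r, 0 <= r < 1 -> 0 < phi r.
Hypothesis M_def : forall s, 0 <= s < 1 ->
  is_max_on (fun r => 0 <= r <= s) (fun r => psi r / phi r) (M s).

Lemma phi_le1 r : 0 <= r <= 1 -> phi r <= 1.
Proof.
intros Hr; rewrite <- phi_0; apply phi_nonincreasing; unfold unit_interval; lra.
Qed.

(** * The supersolution *)

Section Supersolution.

Variables (th rho al C D mu J v0 : R).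
Hypothesis th_bounds : 0 < th <= 1.
Hypothesis rho_bounds : 0 < rho < 1.
Hypothesis C_pos : 0 < C.
Hypothesis D_def : D = 2 * (1 + th) ^ 2 / rho ^ 2.
Hypothesis al_large : 1 <= al * rho ^ 2.
Hypothesis mu_bounds : 0 < mu <= th ^ 2 / (8 * C * (8 + D)).
Hypothesis rho_phi : 1 / 2 <= phi rho.
Hypothesis rho_M : M rho <= 1 + th.
Hypothesis J_bound : forall r, 0 <= r < 1 -> 0 <= Mint M r <= J.
Hypothesis J_small : 2 * C * ((1 + th) ^ 3 / rho ^ 2 + D / (2 * rho)) * mu * J <= th.
Hypothesis v0_lt : v0 < K.
Hypothesis v0_gt : mu / 2 * ((1 + th) ^ 3 * ln (2 * al / th) + D * J) < v0.
Hypothesis C_bound : forall s, 0 < s -> recip_int s <= v0 -> df s <= C.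

Let A3 := (1 + th) ^ 3.
Let c := th / al.
Let B := 2 * C * (A3 / rho ^ 2 + D / (2 * rho)) * mu.
Let a t := phi (radius t).
Let b t := psi (radius t).

Let c_pos : 0 < c.
Proof. exact (proj1 (proj1 (core_bounds th rho al th_bounds rho_bounds al_large))). Qed.

Let D_nonneg : 0 < D.
Proof. apply (drop_coef_pos th rho D th_bounds rho_bounds D_def). Qed.

Let A3_pos : 0 < A3.
Proof. apply pow_lt; lra. Qed.

Let B_nonneg : 0 <= B.
Proof.
assert (0 < A3 / rho ^ 2) by (apply Rdiv_lt_0_compat; [exact A3_pos|apply pow_lt; lra]).
assert (0 < D / (2 * rho)) by (apply Rdiv_lt_0_compat; lra).
unfold B; apply Rmult_le_pos; [|lra]; apply Rmult_le_pos; lra.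
Qed.

Definition drop (t : R) : R := A3 * ln ((t + c) / c) + D * Mint M (sqrt t).

Definition ddrop (t : R) : R := A3 / (t + c) + D * (M (sqrt t) / (2 * sqrt t)).

Definition upper (t : R) : R := recip_int_inv (v0 - mu / 2 * drop t).

(* The flux of a source below [upper] is at most
   [(2 / al) * M (sqrt t) * weight t * cutoff t * f (upper t)].  The factor [cutoff] vanishes
   at [0] and is about [1 + th] for [t] well above [c]; its last factor grows like the integral
   of [M], which pays for [f'] where [phi] degenerates.  [M] is only continuous, so it is kept
   outside of the function that is differentiated. *)
Definition cutoff (t : R) : R := (1 + th) * (t / (t + c)) * (1 + B * Mint M (sqrt t)).

Definition dcutoff (t : R) : R :=
  (1 + th) * (c / (t + c) ^ 2) * (1 + B * Mint M (sqrt t))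
  + (1 + th) * (t / (t + c)) * (B * (M (sqrt t) / (2 * sqrt t))).

Lemma sqrt_bounds t : 0 < t < 1 -> 0 < sqrt t < 1.
Proof.
intros Ht; split; [apply sqrt_lt_R0; lra|].
rewrite <- sqrt_1; apply sqrt_lt_1_alt; lra.
Qed.

Lemma sqrt_lt1 t : t < 1 -> 0 <= sqrt t < 1.
Proof.
intros Ht; split; [apply sqrt_pos|].
destruct (Rle_or_lt 0 t); [|rewrite sqrt_neg_0; lra].
rewrite <- sqrt_1; apply sqrt_lt_1_alt; lra.
Qed.

Lemma is_derive_Mint_sqrt t :
  0 < t < 1 -> is_derive (fun t => Mint M (sqrt t)) t (M (sqrt t) / (2 * sqrt t)).
Proof.
intros Ht; pose proof (sqrt_bounds t Ht).
replace (M (sqrt t) / (2 * sqrt t)) with (scal (/ (2 * sqrt t)) (Mpos M (sqrt t))).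
- apply (is_derive_comp (Mint M) sqrt).
  + apply (is_derive_Mint phi psi M); trivial; lra.
  + auto_derive; [lra|field; lra].
- rewrite Mpos_nonneg by lra; unfold scal; simpl; unfold mult; simpl; field; lra.
Qed.

Lemma continuous_Mint_sqrt t : t < 1 -> continuous (fun t => Mint M (sqrt t)) t.
Proof.
intros Ht; apply (continuous_comp sqrt (Mint M)); [apply continuous_sqrt|].
apply (ex_derive_continuous (Mint M)); eexists; apply (is_derive_Mint phi psi M); trivial.
now apply sqrt_lt1.
Qed.

Lemma is_derive_drop t : 0 < t < 1 -> is_derive drop t (ddrop t).
Proof.
intros Ht; apply (is_derive_plus (fun t => A3 * ln ((t + c) / c)) (fun t => D * Mint M (sqrt t))).
- auto_derive.
  + apply Rdiv_lt_0_compat; lra.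
  + field; lra.
- apply (is_derive_scal (fun t => Mint M (sqrt t))); now apply is_derive_Mint_sqrt.
Qed.

Lemma continuous_drop t : 0 <= t < 1 -> continuous drop t.
Proof.
intros Ht; apply continuous_plus_R.
- apply (ex_derive_continuous (fun t => A3 * ln ((t + c) / c))); auto_derive.
  apply Rdiv_lt_0_compat; lra.
- apply continuous_mult_R; [apply continuous_const|]; apply continuous_Mint_sqrt; lra.
Qed.

(** The argument of the inverse has to stay below [K], where the inverse exists, and above 0, so
    that [upper] is positive. The whole drop is bounded using [t + c <= 2], which yields
    [ln (2 / c) = ln (2 * al / th)], and [J]. *)
Lemma level_bounds t : 0 <= t < 1 -> 0 < v0 - mu / 2 * drop t <= v0.
Proof.
intros Ht; pose proof (J_bound (sqrt t) (sqrt_lt1 t (proj2 Ht))).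
destruct (core_bounds th rho al th_bounds rho_bounds al_large) as [_ Hc1]; fold c in Hc1.
assert (0 <= ln ((t + c) / c)).
{ rewrite <- ln_1; apply ln_le; [lra|]; apply Rle_div_r; lra. }
assert (ln ((t + c) / c) <= ln (2 * al / th)).
{ pose proof (alpha_ge1 rho al rho_bounds al_large).
  replace (2 * al / th) with (2 / c) by (unfold c; field; lra).
  apply ln_le; [apply Rdiv_lt_0_compat; lra|].
  apply Rmult_le_compat_r; [apply Rlt_le, Rinv_0_lt_compat; lra|lra]. }
assert (0 <= drop t) by (apply Rplus_le_le_0_compat; apply Rmult_le_pos; lra).
pose proof v0_gt as Hv0; fold A3 in Hv0.
assert (drop t <= A3 * ln (2 * al / th) + D * J).
{ apply Rplus_le_compat; apply Rmult_le_compat_l; lra. }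
nra.
Qed.

Lemma upper_pos t : 0 <= t < 1 -> 0 < upper t.
Proof.
intros Ht; pose proof (level_bounds t Ht); apply recip_int_inv_pos; lra.
Qed.

Lemma upper_le t : 0 <= t < 1 -> upper t <= recip_int_inv v0.
Proof.
intros Ht; pose proof (level_bounds t Ht); apply recip_int_inv_le; lra.
Qed.

Lemma continuous_upper t : 0 <= t < 1 -> continuous upper t.
Proof.
intros Ht; pose proof (level_bounds t Ht).
apply (continuous_comp (fun t => v0 - mu / 2 * drop t) recip_int_inv).
- apply continuous_plus_R; [apply continuous_const|].
  apply (continuous_opp (fun t => mu / 2 * drop t)), continuous_mult_R;
    [apply continuous_const|now apply continuous_drop].
- apply (ex_derive_continuous recip_int_inv); eexists; apply is_derive_recip_int_inv; lra.
Qed.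

Lemma is_derive_upper t :
  0 < t < 1 -> is_derive upper t (- (mu / 2) * ddrop t * f (upper t)).
Proof.
intros Ht; pose proof (level_bounds t ltac:(lra)); pose proof (upper_pos t ltac:(lra)).
rewrite <- fext_nonneg by lra.
apply (is_derive_comp recip_int_inv (fun t => v0 - mu / 2 * drop t)).
- apply is_derive_recip_int_inv; lra.
- replace (- (mu / 2) * ddrop t) with (0 + - (mu / 2 * ddrop t)) by ring.
  apply (is_derive_plus (fun _ => v0) (fun t => - (mu / 2 * drop t))).
  + apply (is_derive_const (V := R_NormedModule)).
  + apply (is_derive_opp (fun t => mu / 2 * drop t)), (is_derive_scal drop).
    now apply is_derive_drop.
Qed.

Lemma is_derive_f_upper t :
  0 < t < 1 ->
  is_derive (fun t => fext (upper t)) t (- (mu / 2) * ddrop t * f (upper t) * df (upper t)).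
Proof.
intros Ht; apply (is_derive_comp fext upper).
- apply is_derive_fext, upper_pos; lra.
- now apply is_derive_upper.
Qed.

Lemma is_derive_cutoff t : 0 < t < 1 -> is_derive cutoff t (dcutoff t).
Proof.
intros Ht.
apply (is_derive_mult (fun t => (1 + th) * (t / (t + c))) (fun t => 1 + B * Mint M (sqrt t))).
- auto_derive; [lra|field; lra].
- replace (B * (M (sqrt t) / (2 * sqrt t))) with (0 + B * (M (sqrt t) / (2 * sqrt t))) by ring.
  apply (is_derive_plus (fun _ => 1) (fun t => B * Mint M (sqrt t))).
  + apply (is_derive_const (V := R_NormedModule)).
  + apply (is_derive_scal (fun t => Mint M (sqrt t))); now apply is_derive_Mint_sqrt.
- intros; apply Rmult_comm.
Qed.

Lemma continuous_cutoff t : 0 <= t < 1 -> continuous cutoff t.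
Proof.
intros Ht; apply continuous_mult_R.
- apply (ex_derive_continuous (fun t => (1 + th) * (t / (t + c)))); auto_derive; lra.
- apply continuous_plus_R; [apply continuous_const|].
  apply continuous_mult_R; [apply continuous_const|]; apply continuous_Mint_sqrt; lra.
Qed.

Let inner_region t : 0 < t < 1 -> sqrt t <= rho -> 1 / 2 <= a t /\ M (sqrt t) <= 1 + th.
Proof.
intros Ht Hs; pose proof (sqrt_bounds t Ht); split.
- apply Rle_trans with (phi rho); [exact rho_phi|].
  unfold a; rewrite radius_sqrt by lra.
  apply phi_nonincreasing; unfold unit_interval; lra.
- apply Rle_trans with (M rho); [|exact rho_M].
  apply (M_nondecreasing phi psi); trivial; lra.
Qed.

Let a_bounds t : 0 <= a t <= 1.
Proof. split; [apply phi_nonneg, radius_bounds|apply phi_le1, radius_bounds]. Qed.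

Let growth_bounds t : 0 < t < 1 -> 1 <= 1 + B * Mint M (sqrt t) <= 1 + th.
Proof.
intros Ht; pose proof (J_bound (sqrt t) (sqrt_lt1 t (proj2 Ht))).
unfold B, A3 in *; nra.
Qed.

(** It says that [(2 / al) * weight * cutoff * f (upper)] grows at least as fast as
    [weight * a * f (upper)]. The term [a * cutoff] comes from [weight' = (al / 2) * a * weight],
    and the term with [df] from the decrease of [f (upper)]. *)
Lemma cutoff_inequality t :
  0 < t < 1 -> a t + mu / al * df (upper t) * cutoff t * ddrop t
               <= a t * cutoff t + 2 / al * dcutoff t.
Proof.
intros Ht; pose proof (sqrt_bounds t Ht) as Hs.
assert (Hsq : sqrt t ^ 2 = t) by (apply pow2_sqrt; lra).
pose proof (upper_pos t ltac:(lra)) as Hu; pose proof (level_bounds t ltac:(lra)) as Hlev.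
assert (Hdf : 0 <= df (upper t) <= C).
{ split; [now apply df_nonneg|]; apply C_bound; [exact Hu|].
  unfold upper; rewrite recip_int_invK; lra. }
pose proof (barrier_inequality th rho al C D mu th_bounds rho_bounds C_pos D_def al_large
  mu_bounds (sqrt t) (a t) (1 + B * Mint M (sqrt t)) (M (sqrt t)) (df (upper t))
  Hs (a_bounds t) (growth_bounds t Ht)
  (M_ge1 phi psi M phi_0 psi_0 phi_pos M_def _ (sqrt_lt1 t (proj2 Ht))) Hdf
  (inner_region t Ht)) as H.
rewrite Hsq in H; exact H.
Qed.

(** It converts the flux bound into a slope bound: after multiplication by [mu * al / 4] and
    division by [weight t * t], the flux bound becomes at most [- upper']. *)
Lemma cutoff_le_ddrop t : 0 < t < 1 -> M (sqrt t) * cutoff t <= ddrop t * t.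
Proof.
intros Ht; pose proof (sqrt_bounds t Ht) as Hs.
assert (Hsq : sqrt t ^ 2 = t) by (apply pow2_sqrt; lra).
pose proof (barrier_slope_bound th rho al D th_bounds rho_bounds D_def al_large
  (sqrt t) (a t) (1 + B * Mint M (sqrt t)) (M (sqrt t))
  Hs (a_bounds t) (growth_bounds t Ht)
  (M_ge1 phi psi M phi_0 psi_0 phi_pos M_def _ (sqrt_lt1 t (proj2 Ht)))
  (inner_region t Ht)) as H.
rewrite Hsq in H; fold c A3 (ddrop t) in H.
apply (Rmult_le_compat_r t) in H; [|lra].
replace (M (sqrt t) * cutoff t)
  with (M (sqrt t) * ((1 + th) * (1 + B * Mint M (sqrt t)) / (t + c)) * t); [exact H|].
unfold cutoff; field; lra.
Qed.

Let a_cont t : continuous a t.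
Proof.
apply (continuous_on_unit_interval phi radius); trivial;
  [apply radius_bounds|apply continuous_radius].
Qed.

Let b_cont t : continuous b t.
Proof.
apply (continuous_on_unit_interval psi radius); trivial;
  [apply radius_bounds|apply continuous_radius].
Qed.

(** * One iteration step stays below the supersolution *)

Section Comparison.

Variable g : R -> R.
Hypothesis g_cont : forall t, continuous g t.
Hypothesis g_le : forall t, 0 <= t < 1 -> g t <= upper t.

Let src := source b fext g.

Let src_cont t : continuous src t.
Proof.
apply (continuous_source b fext b_cont); [intros s; apply continuous_fext|exact g_cont].
Qed.

Let src_le s t : 0 < s <= t -> t < 1 -> src s <= M (sqrt t) * (a s * f (upper s)).
Proof.
intros Hs Ht.
assert (Hss : 0 <= sqrt s <= sqrt t) by (split; [apply sqrt_pos|apply sqrt_le_1_alt; lra]).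
pose proof (sqrt_lt1 t Ht).
assert (Hb : b s <= M (sqrt t) * a s).
{ unfold a, b; rewrite radius_sqrt by lra; apply (psi_le_M phi psi); trivial; lra. }
assert (Hf : fext (g s) <= f (upper s)).
{ rewrite <- fext_nonneg by (apply Rlt_le, upper_pos; lra).
  apply fext_nondecreasing, g_le; lra. }
assert (0 <= b s) by apply psi_nonneg, radius_bounds.
unfold src, source; rewrite <- Rmult_assoc.
apply Rmult_le_compat; trivial; apply Rlt_le, fext_pos.
Qed.

Lemma flux_le_cutoff t :
  0 < t < 1 ->
  flux a (al / 2) src t
  <= 2 / al * M (sqrt t) * (weight a (al / 2) t * cutoff t * f (upper t)).
Proof.
intros Ht.
set (E := weight a (al / 2)).
pose proof (alpha_ge1 rho al rho_bounds al_large) as Hal.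
(* The end point [t] is fixed, so [N] is a constant in the comparison of derivatives over [0, t];
   [src_le] holds with this [N] for all [s <= t]. *)
set (N := M (sqrt t)).
assert (HN : 1 <= N).
{ apply (M_ge1 phi psi); trivial; apply sqrt_lt1; lra. }
rewrite <- (fext_nonneg (upper t)) by (apply Rlt_le, upper_pos; lra).
set (dEk := fun s => (al / 2 * a s * E s) * cutoff s + E s * dcutoff s).
assert (HEk : forall s, 0 < s < t -> is_derive (fun s => E s * cutoff s) s (dEk s)).
{ intros s Hs; apply (is_derive_mult E cutoff).
  - now apply is_derive_weight.
  - apply is_derive_cutoff; lra.
  - intros; apply Rmult_comm. }
assert (H : - flux a (al / 2) src 0 + 2 / al * N * (E 0 * cutoff 0 * fext (upper 0))
  <= - flux a (al / 2) src t + 2 / al * N * (E t * cutoff t * fext (upper t))).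
{ apply (nondecreasing_of_derive
    (fun s => - flux a (al / 2) src s + 2 / al * N * (E s * cutoff s * fext (upper s)))
    (fun s => - (E s * src s) + 2 / al * N * (dEk s * fext (upper s)
       + E s * cutoff s * (- (mu / 2) * ddrop s * f (upper s) * df (upper s))))); [lra|..].
  - intros s Hs.
    apply (is_derive_plus (fun s => - flux a (al / 2) src s)
             (fun s => 2 / al * N * (E s * cutoff s * fext (upper s)))).
    + apply (is_derive_opp (flux a (al / 2) src)); now apply is_derive_flux.
    + apply (is_derive_scal (fun s => E s * cutoff s * fext (upper s))).
      apply (is_derive_mult (fun s => E s * cutoff s) (fun s => fext (upper s))).
      * now apply HEk.
      * apply is_derive_f_upper; lra.
      * intros; apply Rmult_comm.
  - intros s Hs; apply continuous_plus_R.
    + apply (continuous_opp (flux a (al / 2) src)); now apply continuous_flux.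
    + apply continuous_mult_R; [apply continuous_const|].
      apply continuous_mult_R; [apply continuous_mult_R|].
      * now apply continuous_weight.
      * apply continuous_cutoff; lra.
      * apply (continuous_comp upper fext); [apply continuous_upper; lra|apply continuous_fext].
  - intros s Hs.
    assert (HE : 0 < E s) by apply weight_pos.
    pose proof (upper_pos s ltac:(lra)) as Hu.
    pose proof (f_pos (upper s) ltac:(lra)) as Hf.
    pose proof (cutoff_inequality s ltac:(lra)) as Hk.
    pose proof (src_le s t ltac:(lra) ltac:(lra)) as Hsrc; fold N in Hsrc.
    rewrite fext_nonneg by lra.
    replace (2 / al * N * (dEk s * f (upper s)
       + E s * cutoff s * (- (mu / 2) * ddrop s * f (upper s) * df (upper s))))
      with (E s * (N * f (upper s)
        * (a s * cutoff s + 2 / al * dcutoff s - mu / al * df (upper s) * cutoff s * ddrop s)))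
      by (unfold dEk; field; lra).
    assert (HNf : 0 < N * f (upper s)) by nra.
    assert (N * f (upper s) * a s <= N * f (upper s)
        * (a s * cutoff s + 2 / al * dcutoff s - mu / al * df (upper s) * cutoff s * ddrop s))
      by (apply Rmult_le_compat_l; lra).
    replace (N * (a s * f (upper s))) with (N * f (upper s) * a s) in Hsrc by ring.
    nra. }
assert (Hc0 : cutoff 0 = 0) by (unfold cutoff; field; lra).
rewrite flux_0, Hc0 in H; lra.
Qed.

Lemma picard_le_upper t :
  0 <= t < 1 -> picard a b fext (al / 2) (mu * al / 4) g t <= upper t.
Proof.
intros Ht; unfold picard; fold src.
set (L := linear_solution a (al / 2) (mu * al / 4) src).
pose proof (alpha_ge1 rho al rho_bounds al_large) as Hal.
assert (HLc : forall s, continuous L s) by (intros s; now apply continuous_linear_solution).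
assert (Hslope : forall s, 0 < s < 1 ->
  slope a (al / 2) (mu * al / 4) src s <= mu / 2 * ddrop s * f (upper s)).
{ intros s Hs; rewrite slope_neq0 by lra.
  pose proof (weight_pos a (al / 2) s) as HE.
  pose proof (f_pos (upper s) (Rlt_le _ _ (upper_pos s ltac:(lra)))) as Hf.
  pose proof (flux_le_cutoff s Hs) as Hfl; pose proof (cutoff_le_ddrop s Hs) as Hcd.
  set (E := weight a (al / 2) s) in *.
  apply Rle_div_l; [nra|].
  apply Rle_trans with (mu * al / 4 * (2 / al * M (sqrt s) * (E * cutoff s * f (upper s)))).
  - apply Rmult_le_compat_l; [nra|exact Hfl].
  - replace (mu * al / 4 * (2 / al * M (sqrt s) * (E * cutoff s * f (upper s))))
      with (mu / 2 * f (upper s) * E * (M (sqrt s) * cutoff s)) by (field; lra).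
    replace (mu / 2 * ddrop s * f (upper s) * (E * s))
      with (mu / 2 * f (upper s) * E * (ddrop s * s)) by ring.
    apply Rmult_le_compat_l; [|exact Hcd].
    apply Rmult_le_pos; [apply Rmult_le_pos|]; lra. }
(* [upper] is controlled on [0, 1) only, so the derivatives are compared up to some [s < 1], and
   then [s] tends to 1, where the linear solution vanishes continuously. *)
assert (Hmono : forall s, t <= s < 1 -> L t - L s <= upper t).
{ intros s Hs.
  assert (H : L t - upper t <= L s - upper s).
  { apply (nondecreasing_of_derive (fun t => L t - upper t)
      (fun t => - slope a (al / 2) (mu * al / 4) src t - - (mu / 2) * ddrop t * f (upper t)));
      [lra|..].
    - intros x Hx; apply (is_derive_minus L upper).
      + now apply is_derive_linear_solution.
      + apply is_derive_upper; lra.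
    - intros x Hx; apply (continuous_minus L upper); [apply HLc|apply continuous_upper; lra].
    - intros x Hx; specialize (Hslope x ltac:(lra)); lra. }
  pose proof (upper_pos s ltac:(lra)); lra. }
apply le_epsilon; intros eps Heps.
pose proof (HLc 1) as Hc; apply continuity_pt_filterlim in Hc.
destruct (Hc eps Heps) as [d [Hd Hlim]]; simpl in Hlim; unfold Rdist in Hlim.
set (s := Rmax t (1 - d / 2)).
assert (Hs : t <= s < 1 /\ 1 - d < s) by (unfold s, Rmax; destruct Rle_dec; lra).
assert (HLs : Rabs (L s - L 1) < eps).
{ apply Hlim; split; [split; [exact I|lra]|]; apply Rabs_def1; lra. }
unfold L at 2 in HLs; rewrite linear_solution_1 in HLs; apply Rabs_def2 in HLs.
specialize (Hmono s ltac:(lra)); lra.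
Qed.

End Comparison.

Lemma solvable_of_barrier : solvable f phi psi al (mu * al).
Proof.
pose proof (alpha_ge1 rho al rho_bounds al_large) as Hal.
split; [apply Rmult_lt_0_compat; lra|].
assert (Hl : 0 < mu * al / 4) by nra.
assert (Hb0 : forall t, 0 <= b t) by (intros t; apply psi_nonneg, radius_bounds).
destruct (exists_fixed_point a b fext (al / 2) (mu * al / 4) a_cont b_cont continuous_fext Hl
  Hb0 fext_pos fext_nondecreasing upper (recip_int_inv v0)) as [g [Hg [Hg0 Hfix]]].
{ intros t Ht; split; [now apply Rlt_le, upper_pos|now apply upper_le]. }
{ exact picard_le_upper. }
apply (fixed_point_solution f fext phi psi g); trivial.
- apply continuous_fext.
- apply fext_pos.
- apply fext_nonneg.
- apply Rmult_lt_0_compat; lra.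
Qed.

End Supersolution.

(** * Asymptotics of the extremal parameter *)

Lemma lipschitz_lower_bound (g : R -> R) (e : R) :
  lipschitz_on unit_interval g -> g 0 = 1 -> 0 < e ->
  exists d, 0 < d <= 1 / 2 /\ forall r, 0 <= r <= d -> 1 - e < g r.
Proof.
intros [L HL] Hg He; pose proof (Rabs_pos L); pose proof (Rle_abs L).
set (d := Rmin (1 / 2) (e / (2 * (Rabs L + 1)))).
assert (Hd : 0 < d <= 1 / 2 /\ d <= e / (2 * (Rabs L + 1))).
{ split; [split|]; [apply Rmin_pos; [lra|apply Rdiv_lt_0_compat; lra]|apply Rmin_l|apply Rmin_r]. }
exists d; split; [apply Hd|]; intros r Hr.
specialize (HL r 0); rewrite Hg, Rminus_0_r, (Rabs_pos_eq r) in HL by lra.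
assert (Hr' : r * (2 * (Rabs L + 1)) <= e) by (apply Rle_div_r; lra).
assert (HLr : Rabs (g r - 1) <= L * r) by (apply HL; unfold unit_interval; lra).
apply Rabs_le_between in HLr; nra.
Qed.

Lemma eventually_le_bound (eps : R) : 0 < eps ->
  exists a0, forall al, a0 < al -> 0 < al /\ 1 <= ln al /\ forall lam,
    solvable f phi psi al lam -> lam <= (1 + eps) * (2 * K * al / ln al).
Proof.
intros Heps.
set (A := / (1 + eps / 2)).
assert (HA : 0 < A < 1).
{ split; [apply Rinv_0_lt_compat; lra|]; rewrite <- Rinv_1; apply Rinv_lt_contravar; lra. }
destruct (lipschitz_lower_bound psi (1 - A) psi_lipschitz psi_0) as [d [Hd Hpsi]]; [lra|].
set (c0 := - ln (d ^ 2 / 2)).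
assert (Hd2 : 0 < d ^ 2 / 2) by nra.
(* For [l] beyond this bound [(eps / 2) * l >= (1 + eps) * c0], that is [(1 + eps / 2) * l <= (1 +
   eps) * (l - c0)]: half of the margin pays for [A], the other half for the shift [c0] of the
   logarithm. *)
set (l0 := Rmax 1 (2 * (1 + eps) / eps * c0)).
exists (exp l0); intros al Hal.
assert (Hal0 : 0 < al) by (pose proof (exp_pos l0); lra).
assert (Hl : l0 < ln al).
{ rewrite <- (ln_exp l0); apply ln_increasing; [apply exp_pos|exact Hal]. }
assert (1 <= l0) by apply Rmax_l.
assert (2 * (1 + eps) / eps * c0 <= l0) by apply Rmax_r.
split; [exact Hal0|split; [lra|]].
intros lam [Hlam [u Hu]].
assert (HK : lam * A / (2 * al) * ln (1 + al * d ^ 2 / 2) <= K).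
{ apply (lambda_bound phi psi u); trivial; [lra|]; intros r Hr; split.
  - split; [apply phi_nonneg|apply phi_le1]; lra.
  - specialize (Hpsi r Hr); lra. }
set (l := ln al) in *.
assert (HL : l - c0 <= ln (1 + al * d ^ 2 / 2)).
{ unfold l, c0; replace (ln al - - ln (d ^ 2 / 2)) with (ln al + ln (d ^ 2 / 2)) by ring.
  rewrite <- ln_mult by lra; apply ln_le; [apply Rmult_lt_0_compat; lra|].
  unfold Rdiv; lra. }
assert (Hll : l <= A * (1 + eps) * (l - c0)).
{ assert (H2 : 2 * (1 + eps) / eps * c0 <= l) by lra.
  apply (Rmult_le_compat_l eps) in H2; [|lra].
  replace (eps * (2 * (1 + eps) / eps * c0)) with (2 * (1 + eps) * c0) in H2 by (field; lra).
  apply Rmult_le_reg_l with (1 + eps / 2); [lra|].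
  replace ((1 + eps / 2) * (A * (1 + eps) * (l - c0))) with ((1 + eps) * (l - c0))
    by (unfold A; field; lra).
  lra. }
assert (HK2 : lam * A * (l - c0) <= 2 * al * K).
{ apply Rle_trans with (2 * al * (lam * A / (2 * al) * ln (1 + al * d ^ 2 / 2))).
  - replace (2 * al * (lam * A / (2 * al) * ln (1 + al * d ^ 2 / 2)))
      with (lam * A * ln (1 + al * d ^ 2 / 2)) by (field; lra).
    apply Rmult_le_compat_l; [apply Rmult_le_pos; lra|exact HL].
  - apply Rmult_le_compat_l; lra. }
replace ((1 + eps) * (2 * K * al / l)) with ((1 + eps) * (2 * al * K) / l) by (field; lra).
apply Rle_div_r; [lra|].
apply Rle_trans with (lam * (A * (1 + eps) * (l - c0))); [apply Rmult_le_compat_l; lra|].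
replace (lam * (A * (1 + eps) * (l - c0))) with ((1 + eps) * (lam * A * (l - c0))) by ring.
apply Rmult_le_compat_l; lra.
Qed.

Hypothesis M_integrable : ex_RInt_gen M (at_point 0) (at_left 1).

Lemma eventually_solvable (eps : R) : 0 < eps < 1 ->
  exists a0, forall al, a0 < al -> solvable f phi psi al ((1 - eps) * (2 * K * al / ln al)).
Proof.
intros Heps.
pose proof K_pos as HK.
(* Small enough for [(1 + th)^3 <= 1 + eps / 2]. *)
set (th := eps / 8).
destruct (Mint_bounded phi psi M) as [J HJ]; trivial.
assert (HJ0 : 0 <= J) by (pose proof (HJ 0 ltac:(lra)); lra).
destruct (lipschitz_lower_bound phi (1 / 2) phi_lipschitz phi_0) as [d1 [Hd1 Hphi]]; [lra|].
assert (HMc : continuous (Mpos M) 0) by (apply (continuous_Mpos phi psi M); trivial; lra).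
apply continuity_pt_filterlim in HMc.
destruct (HMc th) as [d2 [Hd2 HM]]; [unfold th; lra|]; simpl in HM; unfold Rdist in HM.
(* Below [d1], [phi] is at least [1 / 2]; below [d2], [M] is within [th] of [M 0 = 1]. *)
set (rho := Rmin d1 (d2 / 2)).
assert (Hrho : 0 < rho <= d1 /\ rho < d2) by (unfold rho, Rmin; destruct Rle_dec; lra).
assert (HMrho : M rho <= 1 + th).
{ assert (H : Rabs (Mpos M rho - Mpos M 0) < th).
  { apply HM; split; [split; [exact I|lra]|]; apply Rabs_def1; lra. }
  rewrite !Mpos_nonneg in H by lra.
  rewrite (M_at_0 phi psi M) in H by trivial.
  apply Rabs_def2 in H; lra. }
set (v0 := (1 - eps / 2) * K).
(* By [df_le] this bounds [f'] wherever [recip_int s <= v0]; it does not depend on [alpha]. *)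
set (C := fext (recip_int_inv v0 + 1)).
assert (HC : 0 < C) by apply fext_pos.
set (D := 2 * (1 + th) ^ 2 / rho ^ 2).
assert (HD : 0 < D).
{ apply Rdiv_lt_0_compat; [|apply pow_lt; lra].
  assert (0 < (1 + th) ^ 2) by (apply pow_lt; unfold th; lra); lra. }
set (A3 := (1 + th) ^ 3).
assert (HA3 : 1 <= A3 <= 1 + eps / 2).
{ unfold A3, th; split; [apply pow_R1_Rle; lra|].
  assert (0 <= eps ^ 2 <= eps) by nra.
  assert (eps ^ 3 <= eps) by nra; nra. }
set (Q := A3 / rho ^ 2 + D / (2 * rho)).
assert (HQ : 0 < Q).
{ apply Rplus_lt_0_compat; apply Rdiv_lt_0_compat; try lra; apply pow_lt; lra. }
set (X1 := th ^ 2 / (8 * C * (8 + D))).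
assert (HX1 : 0 < X1).
{ apply Rdiv_lt_0_compat; [apply pow_lt; unfold th; lra|]; apply Rmult_lt_0_compat; lra. }
set (X2 := th / (2 * C * Q * J + 1)).
assert (HCQJ : 0 <= 2 * C * Q * J).
{ apply Rmult_le_pos; [|exact HJ0]; apply Rmult_le_pos; lra. }
assert (HX2 : 0 < X2) by (apply Rdiv_lt_0_compat; unfold th; lra).
set (c2 := Rabs (A3 * ln (2 / th) + D * J)).
assert (Hc2 : 0 <= c2) by apply Rabs_pos.
(* The terms with [X1] and [X2] make [mu] small enough for the two smallness hypotheses. The last
   one comes from [(1 - eps) * (1 + eps / 2) = (1 - eps / 2) - eps^2 / 2]: the room [eps^2 / 2]
   below [v0 / K] has to absorb [c2 / l]. *)
set (l0 := 1 + 2 * K / X1 + 2 * K / X2 + 2 * c2 / eps ^ 2).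
assert (He2 : 0 < eps ^ 2) by (apply pow_lt; lra).
exists (Rmax (/ rho ^ 2) (exp l0)); intros al Hal.
assert (Hal1 : / rho ^ 2 < al) by (pose proof (Rmax_l (/ rho ^ 2) (exp l0)); lra).
assert (Hal2 : exp l0 < al) by (pose proof (Rmax_r (/ rho ^ 2) (exp l0)); lra).
assert (Hal0 : 0 < al) by (pose proof (exp_pos l0); lra).
set (l := ln al).
assert (Hl : l0 < l).
{ rewrite <- (ln_exp l0); apply ln_increasing; [apply exp_pos|exact Hal2]. }
assert (H1 : 0 <= 2 * K / X1) by (apply Rdiv_le_0_compat; lra).
assert (H2 : 0 <= 2 * K / X2) by (apply Rdiv_le_0_compat; lra).
assert (H3 : 0 <= 2 * c2 / eps ^ 2) by (apply Rdiv_le_0_compat; lra).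
unfold l0 in Hl.
set (mu := (1 - eps) * (2 * K) / l).
assert (Hmu0 : 0 < mu).
{ apply Rdiv_lt_0_compat; [apply Rmult_lt_0_compat|]; lra. }
assert (Hmu : forall X, 0 < X -> 2 * K / X <= l -> mu <= X).
{ intros X HX HlX; apply Rle_div_l; [lra|].
  apply Rle_div_l in HlX; [|exact HX]; nra. }
replace ((1 - eps) * (2 * K * al / l)) with (mu * al) by (unfold mu; field; lra).
apply (solvable_of_barrier th rho al C D mu J v0).
- unfold th; lra.
- lra.
- exact HC.
- reflexivity.
- assert (0 < rho ^ 2) by (apply pow_lt; lra).
  apply (Rmult_lt_compat_r (rho ^ 2)) in Hal1; [|assumption].
  rewrite Rinv_l in Hal1 by lra; lra.
- split; [exact Hmu0|]; apply Hmu; trivial; fold X1; lra.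
- specialize (Hphi rho ltac:(lra)); lra.
- exact HMrho.
- exact HJ.
- fold A3 Q.
  assert (Hm2 : mu <= X2) by (apply Hmu; lra).
  apply Rle_div_r in Hm2; [|lra].
  replace (2 * C * Q * mu * J) with (mu * (2 * C * Q * J)) by ring; nra.
- unfold v0; nra.
- fold A3.
  replace (2 * al / th) with (al * (2 / th)) by (unfold th; field; lra).
  rewrite ln_mult by (try apply Rdiv_lt_0_compat; unfold th; lra); fold l.
  assert (Hc : A3 * (l + ln (2 / th)) + D * J <= (1 + eps / 2) * l + c2).
  { pose proof (Rle_abs (A3 * ln (2 / th) + D * J)) as Habs; fold c2 in Habs; nra. }
  assert (Hcl : 2 * c2 < l * eps ^ 2).
  { apply Rlt_div_l; lra. }
  apply Rle_lt_trans with (mu / 2 * ((1 + eps / 2) * l + c2)).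
  { apply Rmult_le_compat_l; lra. }
  replace (mu / 2 * ((1 + eps / 2) * l + c2))
    with (K * ((1 - eps) * ((1 + eps / 2) * l + c2)) / l) by (unfold mu; field; lra).
  apply Rlt_div_l; [lra|]; unfold v0.
  replace ((1 - eps / 2) * K * l) with (K * ((1 - eps / 2) * l)) by ring.
  apply Rmult_lt_compat_l; [exact HK|]; nra.
- intros s Hs Hsv.
  apply Rle_trans with (f (s + 1)); [now apply df_le|].
  rewrite <- fext_nonneg by lra; apply fext_nondecreasing.
  assert (s <= recip_int_inv v0); [|lra].
  apply Rnot_lt_le; intros Hlt; apply recip_int_increasing in Hlt.
  rewrite recip_int_invK in Hlt; [lra|unfold v0; nra].
Qed.

End Problem.

(* [is_lim] reads [lambda_star] through the coercion [real], which sends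
   infinite values to 0; a limit equal to 1 thus includes eventual finiteness. *)
Theorem theorem1p1 (f phi psi M : R -> R) (K : R)
  (f_pos : forall s, 0 <= s -> 0 < f s)
  (f_C1 : C1_on nonneg_reals f)
  (f_convex : convex_on nonneg_reals f)
  (f_nondecreasing : nondecreasing_on nonneg_reals f)
  (K_def : is_RInt_gen (fun s => / f s) (at_point 0) (Rbar_locally p_infty) K)
  (phi_nonneg : forall r, 0 <= r <= 1 -> 0 <= phi r)
  (psi_nonneg : forall r, 0 <= r <= 1 -> 0 <= psi r)
  (phi_nonincreasing : nonincreasing_on unit_interval phi)
  (psi_nonincreasing : nonincreasing_on unit_interval psi)
  (phi_lipschitz : lipschitz_on unit_interval phi)
  (psi_lipschitz : lipschitz_on unit_interval psi)
  (phi_0 : phi 0 = 1)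
  (psi_0 : psi 0 = 1)
  (phi_pos : forall r, 0 <= r < 1 -> 0 < phi r)
  (M_def : forall s, 0 <= s < 1 ->
     is_max_on (fun r => 0 <= r <= s) (fun r => psi r / phi r) (M s))
  (M_integrable : ex_RInt_gen M (at_point 0) (at_left 1)) :
  is_lim (fun alpha => real (lambda_star f phi psi alpha)
                       * / (2 * K * alpha / ln alpha))
    p_infty 1.
Proof.
destruct f_C1 as [df Hdf].
assert (f_df : forall s, 0 <= s -> D_in f df nonneg_reals s) by (intros s Hs; now apply Hdf).
assert (HK : 0 < K) by exact (K_pos f df K f_pos f_df K_def).
apply is_lim_spec; intros eps.
(* Halving makes the final inequalities strict; [1 / 2] keeps [e] below 1, as [eventually_solvable]
   requires. *)
set (e := Rmin (eps / 2) (1 / 2)).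
assert (He : 0 < e <= 1 / 2 /\ e < eps).
{ pose proof (cond_pos eps); unfold e, Rmin; destruct Rle_dec; lra. }
destruct (eventually_le_bound f df K f_pos f_df f_nondecreasing K_def phi psi phi_nonneg
  phi_nonincreasing psi_lipschitz phi_0 psi_0 e) as [a1 Hup]; [lra|].
destruct (eventually_solvable f df K f_pos f_df f_convex f_nondecreasing K_def phi psi M
  phi_nonneg psi_nonneg phi_nonincreasing phi_lipschitz psi_lipschitz phi_0 psi_0 phi_pos
  M_def M_integrable e) as [a2 Hlow]; [lra|].
exists (Rmax a1 a2); intros al Hal.
pose proof (Rmax_l a1 a2); pose proof (Rmax_r a1 a2).
destruct (Hup al ltac:(lra)) as [Hal0 [Hln Hub]].
specialize (Hlow al ltac:(lra)).
set (X := 2 * K * al / ln al) in *.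
assert (HX : 0 < X) by (apply Rdiv_lt_0_compat; [apply Rmult_lt_0_compat|]; lra).
destruct (Lub_Rbar_correct (solvable f phi psi al)) as [Hge Hle].
fold (lambda_star f phi psi al) in Hge, Hle.
specialize (Hge _ Hlow); specialize (Hle (Finite ((1 + e) * X)) Hub).
destruct (lambda_star f phi psi al) as [L| |]; simpl in Hge, Hle; try contradiction.
simpl; fold (L / X).
assert (1 - e <= L / X) by (apply Rle_div_r; lra).
assert (L / X <= 1 + e) by (apply Rle_div_l; lra).
apply Rabs_def1; lra.
Qed.
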